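(* Fix $j\in\{1,2\}$. Let $h_1,\dots,h_m$ be twice continuously differentiable. Suppose the following conditions hold: 1. $f_0(z),f_j(z)$ are twice continuously differentiable. 2. The problem $\min_{z\in\mathcal Z}f_0(z)$ has a unique minimizer $z_0$ over $\mathcal Z$. 3. (Inf-compactness) There exist constants $\alpha$ and $t_0\in(0,1]$ such that the sublevel set $\{z\in\mathcal Z: f_0(z)+t(f_j(z)-f_0(z))\le\alpha\}$ is nonempty and uniformly bounded over $t\in[0,t_0)$. 4. $z_0$ is associated with a unique Lagrangian multiplier $\nu_0\in\mathbb R^m$, which also satisfies strict complementarity: $\nu_{0,k}>0$ if $k\in K_h(z_0)$, where $K_h(z_0)=\{k: h_k(z_0)=0,\ k=s+1,\dots,m\}$ is the index set of inequality constraints active at $z_0$. 5. (Mangasarian-Fromovitz constraint qualification at $z_0$) $\nabla h_1(z_0),\dots,\nabla h_s(z_0)$ are linearly independent, and there exists $d_z\in\mathbb R^d$ such that $\nabla h_k(z_0)^\top d_z=0$ for $k=1,\dots,s$ and $\nabla h_k(z_0)^\top d_z<0$ for $k\in K_h(z_0)$. 6. (Second order sufficient condition) $$d_z^\top\Big(\nabla^2f_0(z_0)+\sum_{k=1}^m\nu_{0,k}\nabla^2h_k(z_0)\Big)d_z>0\quad\forall d_z\in C(z_0)\setminus\{0\},$$ where $C(z_0)=\{d_z: d_z^\top\nabla h_k(z_0)=0\text{ for }k\in\{1,\dots,s\}\cup K_h(z_0)\}$. Let $A$ be the $(s+|K_h(z_0)|)\times d$ matrix whose rows are $\nabla h_k(z_0)^\top$,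 $k\in\{1,\dots,s\}\cup K_h(z_0)$, and let $d_z^{j*}\in\mathbb R^d$ be the first part of the (unique) solution $(d_z^{j},\xi)$ of the linear system $$\begin{bmatrix} \nabla^2f_0(z_0)+\sum_{k=1}^m\nu_{0,k}\nabla^2h_k(z_0) & A^\top \\ A & 0 \end{bmatrix}\begin{bmatrix} d_z^j \\ \xi \end{bmatrix}=\begin{bmatrix} -(\nabla f_j(z_0)-\nabla f_0(z_0)) \\ 0 \end{bmatrix}.$$ Then, as $t\downarrow0$, $$v_j(t)=(1-t)f_0(z_0)+tf_j(z_0)+\tfrac12t^2\Big\{d_z^{j*\top}\Big(\nabla^2f_0(z_0)+\sum_{k=1}^m\nu_{0,k}\nabla^2h_k(z_0)\Big)d_z^{j*}+2d_z^{j*\top}\big(\nabla f_j(z_0)-\nabla f_0(z_0)\big)\Big\}+o(t^2),$$ $$z_j(t)=z_0+t\,d_z^{j*}+o(t).$$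
   Context: $(X,Y)$ is a random pair with $X$ taking values in $\mathbb R^p$ and $Y$ in a set $\mathcal Y$; $c(z;y)$ is a real-valued cost function. $R_0\subseteq\mathbb R^p$ is a region with a subpartition $R_0=R_1\cup R_2$, $R_1\cap R_2=\varnothing$. For $j=0,1,2$, $f_j(z)=\mathbb E[c(z;Y)\mid X\in R_j]$ for $z\in\mathbb R^d$. The feasible set is $\mathcal Z=\{z\in\mathbb R^d: h_k(z)=0,\ k=1,\dots,s,\ h_k(z)\le0,\ k=s+1,\dots,m\}$ for known functions $h_k:\mathbb R^d\to\mathbb R$. For $j=1,2$ and $t\in[0,1]$, $v_j(t)=\min_{z\in\mathcal Z}\{f_0(z)+t(f_j(z)-f_0(z))\}$ and $z_j(t)$ is any element of $\arg\min_{z\in\mathcal Z}\{f_0(z)+t(f_j(z)-f_0(z))\}$. A Lagrangian multiplier associated with $z_0$ is a vector $\nu\in\mathbb R^m$ with $\nabla f_0(z_0)+\sum_{k=1}^m\nu_k\nabla h_k(z_0)=0$, and $\nu_k\ge0$, $\nu_kh_k(z_0)=0$ for $k=s+1,\dots,m$. *)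

(* Defs.v *)
From HB Require Import structures.
From mathcomp Require Import all_boot all_order all_algebra.
From mathcomp Require Import all_classical all_reals all_analysis.

Set Implicit Arguments.
Unset Strict Implicit.
Unset Printing Implicit Defensive.

Import Order.TTheory GRing.Theory Num.Theory.
Import numFieldNormedType.Exports.

Local Open Scope classical_set_scope.
Local Open Scope ring_scope.

Definition borelRn (R : realType) (n : nat) :=
  g_sigma_algebraType (@open 'cV[R]_n).

(* E[f | D] = E[f ; D] / P(D); meaningful when P(D) > 0 and f is integrable
   on D, junk otherwise. *)
Definition cond_expectation (dO : measure_display) (Omega : measurableType dO)
    (R : realType) (P : probability Omega R) (D : set Omega) (f : Omega -> R) :
    R :=
  Rintegral P D f / fine (P D).

Definition regional_cost (dO dY : measure_display) (Omega : measurableType dO)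
    (TY : measurableType dY) (R : realType) (P : probability Omega R)
    (p d : nat) (X : Omega -> 'cV[R]_p) (Y : Omega -> TY)
    (c : 'cV[R]_d -> TY -> R) (region : 'I_3 -> set 'cV[R]_p) (k : 'I_3)
    (z : 'cV[R]_d) : R :=
  cond_expectation P (X @^-1` region k) (fun w => c z (Y w)).

Section Calculus.
Variables (R : realType) (d : nat).
Implicit Types (f : 'cV[R]_d -> R) (z u v : 'cV[R]_d).

Definition grad f z : 'cV[R]_d := \col_i 'D_(delta_mx i 0) f z.

Definition hess f z : 'M[R]_d :=
  \matrix_(i, j) 'D_(delta_mx j 0) (fun y => 'D_(delta_mx i 0) f y) z.

(* Differentiability is in the Fréchet sense. *)
Definition twice_continuously_differentiable f : Prop :=
  [/\ forall z, differentiable f z,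
      forall z, differentiable (grad f) z
    & continuous (hess f)].

Definition dot u v : R := (u^T *m v) 0 0.

End Calculus.

Section Optimization.
Variables (R : realType) (d : nat).
Implicit Types (F : 'cV[R]_d -> R) (Z : set 'cV[R]_d).

Definition argmin F Z : set 'cV[R]_d :=
  [set z | Z z /\ forall w, Z w -> F z <= F w].

Definition is_min (A : set R) (x : R) : Prop := A x /\ lbound A x.

(* The constraints are indexed from 0: h k is an equality constraint for k < s
   and an inequality constraint for s <= k < m. *)
Variables (m s : nat) (h : 'I_m -> 'cV[R]_d -> R).
Implicit Types (z u : 'cV[R]_d) (nu : 'cV[R]_m).

Definition feasible : set 'cV[R]_d :=
  [set z | (forall k : 'I_m, (k < s)%N -> h k z = 0) /\
           (forall k : 'I_m, (s <= k)%N -> h k z <= 0)].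

Definition eq_idx : {set 'I_m} := [set k : 'I_m | (k < s)%N].

Definition active_ineq z : {set 'I_m} :=
  [set k : 'I_m | (s <= k)%N && (h k z == 0)].

Definition lagrange_multiplier F z nu : Prop :=
  grad F z + \sum_k nu k 0 *: grad (h k) z = 0 /\
  (forall k : 'I_m, (s <= k)%N -> 0 <= nu k 0 /\ nu k 0 * h k z = 0).

Definition hess_lagrangian F z nu : 'M[R]_d :=
  hess F z + \sum_k nu k 0 *: hess (h k) z.

Definition mangasarian_fromovitz z : Prop :=
  free [seq grad (h k) z | k in eq_idx] /\
  exists u, (forall k, k \in eq_idx -> dot (grad (h k) z) u = 0) /\
            (forall k, k \in active_ineq z -> dot (grad (h k) z) u < 0).

Definition critical_cone z : set 'cV[R]_d :=
  [set u | forall k, k \in eq_idx :|: active_ineq z ->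
             dot u (grad (h k) z) = 0].

Definition active_jacobian z : 'M[R]_(#|eq_idx :|: active_ineq z|, d) :=
  \matrix_(i, l) grad (h (enum_val i)) z l 0.

Definition kkt_matrix F z nu :
    'M[R]_(d + #|eq_idx :|: active_ineq z|) :=
  block_mx (hess_lagrangian F z nu) (active_jacobian z)^T
           (active_jacobian z) 0.

End Optimization.

(* Main.v *)
Require Import Defs.
From HB Require Import structures.
From mathcomp Require Import all_boot all_order all_algebra.
From mathcomp Require Import all_classical all_reals all_analysis.
From mathcomp Require Import ring lra.

Set Implicit Arguments.
Unset Strict Implicit.
Unset Printing Implicit Defensive.

Import Order.TTheory GRing.Theory Num.Theory.
Import numFieldNormedType.Exports.

Local Open Scope classical_set_scope.
Local Open Scope ring_scope.

(** Write f_t = f0 + t (fj - f0), G = fj - f0, let (dz, xi) solve the linear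
    system and put q = 1/2 dz.H dz + dz.g, so that the announced value is
    f0 z0 + t G z0 + t^2 q.  Two bounds on f_t near z0 meet at that value.

    Lower bound, [lower_growth].  The Lagrangian L takes the value f0 z0 at z0,
    has zero gradient and Hessian H there.  Strict complementarity turns each
    active inequality into a penalty: on the feasible set
    f0 >= L + c |hS|, where hS collects the active constraints
    ([lagrangian_penalty]).  The matrix H is positive only on the kernel of the
    Jacobian A of hS, but H + rho A^T A is positive definite ([finsler]), and
    the term rho |A u|^2 so added is of second order in hS, hence dominated by
    the first-order penalty.  Recentring the quadratic model at t dz
    ([quad_shift]) produces one more term t xi.(A u), and for small t the
    penalty dominates it too.  What remains is
    f_t z >= f0 z0 + t G z0 + t^2 q + kappa |z - z0 - t dz|^2 - o(t^2).

    Upper bound, [upper_growth].  There are feasible points z0 + t dz + o(t)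
    at which every active constraint vanishes, so that f0 = L there
    ([feasible_curve]).  They come from correcting z0 + t dz by a contraction
    ([feasible_correction]), which needs A to have a right inverse.  It has one
    because a linear relation between active gradients, added to nu0 with a
    small coefficient, would give a second multiplier: strict complementarity
    keeps the signs right ([active_jacobian_row_free]).

    Minimizers of f_t tend to z0 by compactness ([argmin_stability]), so both
    bounds apply at zj t.  Their comparison gives v t up to o(t^2) and
    kappa |zj t - z0 - t dz|^2 = o(t^2), which are the two expansions. *)

(** * Column vectors with the sup norm *)

Section Vectors.
Variables (R : realType).

Lemma near_dist (V : normedModType R) (z : V) (e : R) :
  0 < e -> \forall w \near z, `|w - z| < e.
Proof.
move=> e0; near=> w; rewrite distrC.
suff : ball z e w by rewrite -ball_normE.
by near: w; exact: nbhsx_ballx.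
Unshelve. all: by end_near. Qed.

Lemma nearP_dist (V : normedModType R) (z : V) (P : set V) :
  (\forall w \near z, P w) ->
  exists2 e : R, 0 < e & forall w, `|w - z| < e -> P w.
Proof.
move=> /nbhs_ballP[e /= e0 eP]; exists e => // w wz; apply: eP.
by rewrite -ball_normE /= distrC.
Qed.

Lemma epsilon_continuous (V W : normedModType R) (f : V -> W) :
  (forall z e, 0 < e ->
     exists2 r, 0 < r & forall w, `|w - z| < r -> `|f w - f z| <= e) ->
  continuous f.
Proof.
move=> fc z; apply/cvgrPdist_le => e e0.
have [r r0 fr] := fc z e e0.
by near=> w; rewrite distrC fr//; near: w; exact: near_dist.
Unshelve. all: by end_near. Qed.

Lemma continuous_dist (V W : normedModType R) (f : V -> W) z e :
  continuous f -> 0 < e ->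
  exists2 r, 0 < r & forall w, `|w - z| < r -> `|f w - f z| < e.
Proof.
move=> cf e0; apply: nearP_dist; near=> w; rewrite distrC.
by near: w; move/cvgrPdist_lt : (cf z); exact.
Unshelve. all: by end_near. Qed.

Lemma dotE d (u v : 'cV[R]_d) : dot u v = \sum_i u i 0 * v i 0.
Proof. by rewrite /dot !mxE; apply: eq_bigr => i _; rewrite !mxE. Qed.

Lemma dotC d (u v : 'cV[R]_d) : dot u v = dot v u.
Proof. by rewrite !dotE; apply: eq_bigr => i _; rewrite mulrC. Qed.

Lemma dotDr d (u v w : 'cV[R]_d) : dot u (v + w) = dot u v + dot u w.
Proof. by rewrite /dot mulmxDr mxE. Qed.

Lemma dotZr d k (u v : 'cV[R]_d) : dot u (k *: v) = k * dot u v.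
Proof. by rewrite /dot -scalemxAr mxE. Qed.

Lemma dotDl d (u v w : 'cV[R]_d) : dot (v + w) u = dot v u + dot w u.
Proof. by rewrite dotC dotDr !(dotC u). Qed.

Lemma dotZl d k (u v : 'cV[R]_d) : dot (k *: u) v = k * dot u v.
Proof. by rewrite dotC dotZr dotC. Qed.

Lemma dotNr d (u v : 'cV[R]_d) : dot u (- v) = - dot u v.
Proof. by rewrite -scaleN1r dotZr mulN1r. Qed.

Lemma dotBr d (u v w : 'cV[R]_d) : dot u (v - w) = dot u v - dot u w.
Proof. by rewrite dotDr dotNr. Qed.

Lemma dotBl d (u v w : 'cV[R]_d) : dot (v - w) u = dot v u - dot w u.
Proof. by rewrite dotC dotBr !(dotC u). Qed.

Lemma dot0r d (u : 'cV[R]_d) : dot u 0 = 0.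
Proof. by rewrite /dot mulmx0 mxE. Qed.

Lemma dot_mulmx m n (u : 'cV[R]_m) (M : 'M[R]_(m, n)) (v : 'cV[R]_n) :
  dot u (M *m v) = dot (M^T *m u) v.
Proof. by rewrite /dot trmx_mul trmxK mulmxA. Qed.

Lemma mx_entry_le m n (M : 'M[R]_(m, n)) i j : `|M i j| <= `|M|.
Proof.
rewrite [leRHS]/Num.Def.normr/= mx_normrE.
exact: (le_bigmax _ (fun ij : 'I_m * 'I_n => `|M ij.1 ij.2|) (i, j)).
Qed.

Lemma mx_norm_le m n (M : 'M[R]_(m, n)) (e : R) :
  0 <= e -> (forall i j, `|M i j| <= e) -> `|M| <= e.
Proof.
move=> e0 Me; rewrite [leLHS]/Num.Def.normr/= mx_normrE.
by apply: bigmax_le => // -[i j] _; exact: Me.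
Qed.

(** The dimension appears because the norm of vectors is the sup norm. *)
Lemma dot_le d (u v : 'cV[R]_d) : `|dot u v| <= d%:R * (`|u| * `|v|).
Proof.
rewrite dotE (le_trans (ler_norm_sum _ _ _))//.
apply: (@le_trans _ _ (\sum_(i < d) `|u| * `|v|)).
  apply: ler_sum => i _; rewrite normrM ler_pM//; exact: mx_entry_le.
by rewrite sumr_const card_ord mulr_natl.
Qed.

Lemma mulmx_le m n (M : 'M[R]_(m, n)) :
  exists2 C, 0 < C & forall v : 'cV[R]_n, `|M *m v| <= C * `|v|.
Proof.
exists (n%:R * `|M| + 1) => [|v]; first by rewrite ltr_wpDl.
apply: (@le_trans _ _ (n%:R * `|M| * `|v|)); last first.
  by rewrite ler_wpM2r// lerDl.
apply: mx_norm_le => [|i j]; first by rewrite !mulr_ge0.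
rewrite mxE (le_trans (ler_norm_sum _ _ _))//.
apply: (@le_trans _ _ (\sum_(k < n) `|M| * `|v|)).
  apply: ler_sum => k _; rewrite normrM ler_pM//; exact: mx_entry_le.
by rewrite sumr_const card_ord -mulrA mulr_natl.
Qed.

Lemma mulmx_continuous m n (M : 'M[R]_(m, n)) :
  continuous (fun v : 'cV[R]_n => M *m v).
Proof.
have [C C0 MC] := mulmx_le M.
apply: epsilon_continuous => v e e0; exists (e / C) => [|w wv].
  exact: divr_gt0.
by rewrite -mulmxBr (le_trans (MC _))// mulrC -ler_pdivlMr// ltW.
Qed.

Lemma dot_continuous (T : topologicalType) d (f g : T -> 'cV[R]_d) :
  continuous f -> continuous g -> continuous (fun x => dot (f x) (g x)).
Proof.
move=> cf cg x.
have -> : (fun x => dot (f x) (g x)) = (fun x => \sum_i f x i 0 * g x i 0).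
  by apply/funext => y; rewrite dotE.
apply: cvg_big => [|i _].
  exact: add_continuous.
apply: cvgM.
  apply: (@continuous_comp _ _ _ f (fun u : 'cV[R]_d => u i 0)).
    exact: cf.
  exact: coord_continuous.
apply: (@continuous_comp _ _ _ g (fun u : 'cV[R]_d => u i 0)).
  exact: cg.
exact: coord_continuous.
Qed.

(** Heine-Borel, transported by transposition from row vectors. *)
Lemma cV_bounded_closed_compact d (A : set 'cV[R]_d) (M : R) :
  (forall z, A z -> `|z| <= M) -> closed A -> compact A.
Proof.
move=> AM clA.
have trc m n : continuous (@trmx R m n).
  apply: epsilon_continuous => z e e0; exists e => // w /ltW zw.
  apply: mx_norm_le => [|i k]; first exact: ltW.
  by apply: le_trans zw; have := mx_entry_le (w - z) k i; rewrite !mxE.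
have trN m n (z : 'M[R]_(m, n)) : `|z^T| <= `|z|.
  by apply: mx_norm_le => // i k; rewrite mxE; exact: mx_entry_le.
pose B := [set w : 'rV[R]_d | A w^T].
have -> : A = trmx @` B.
  apply/seteqP; split=> [z Az|_ [w Bw <-]]; last exact: Bw.
  by exists z^T; rewrite /B/= trmxK.
apply: continuous_compact.
  exact: (continuous_subspaceT (trc _ _)).
apply: bounded_closed_compact.
  exists M; split=> [|x Mx w Bw]; first exact: num_real.
  apply: le_trans (ltW Mx); apply: le_trans (AM _ Bw).
  by have := trN _ _ w^T; rewrite trmxK.
exact: (closed_comp (fun w _ => trc _ _ w) clA).
Qed.

End Vectors.

(** * Second-order calculus from Frechet derivatives *)

Section Calculus.
Variables (R : realType) (d : nat).
Implicit Types (f : 'cV[R]_d -> R) (z u v : 'cV[R]_d).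

Lemma diff_bound (V W : normedModType R) (f : V -> W) (z : V) (e : R) :
  differentiable f z -> 0 < e ->
  exists2 r, 0 < r & forall w, `|w - z| < r ->
    `|f w - f z - 'd f z (w - z)| <= e * `|w - z|.
Proof.
move=> /diff_locally /eqaddoP /(_ e) + e0 => /(_ e0) /nearP_dist[r r0 H].
exists r => // w wz; have := H (w - z); rewrite subr0 => /(_ wz).
by rewrite !fctE /= subrK opprD addrA.
Qed.

Lemma col_sum_delta v : v = \sum_i v i 0 *: delta_mx i 0.
Proof.
rewrite {1}(matrix_sum_delta v); apply: eq_bigr => i _.
by rewrite big_ord1.
Qed.

Lemma diff_grad f z u : differentiable f z -> 'd f z u = dot (grad f z) u.
Proof.
move=> df; rewrite {1}(col_sum_delta u) linear_sum dotE; apply: eq_bigr => i _.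
by rewrite linearZ/= mxE deriveE// mulrC.
Qed.

Lemma diff_gradient_map f z u :
  differentiable (grad f) z -> 'd (grad f) z u = hess f z *m u.
Proof.
move=> df; apply/colP => i; rewrite mxE.
have df_i (w : 'cV[R]_d) : ('d (grad f) z w) i 0 =
    'D_w (fun y => 'D_(delta_mx i 0) f y) z.
  rewrite -deriveE// derive_mx ?mxE; last exact: diff_derivable.
  by congr ('D_w _ z); apply/funext => y; rewrite mxE.
rewrite {1}(col_sum_delta u) linear_sum summxE; apply: eq_bigr => k _.
by rewrite linearZ/= mxE df_i mxE mulrC.
Qed.

Lemma is_derive_line f z u (t : R) : (forall y, differentiable f y) ->
  is_derive t 1 (fun s => f (z + s *: u)) (dot (grad f (z + t *: u)) u).
Proof.
move=> df; pose g := fun s : R => z + s *: u.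
have dg : is_diff t g ( *:%R ^~ u).
  have : is_diff t (cst z + ( *:%R ^~ u)) (0 + ( *:%R ^~ u)) by exact: is_diffD.
  by rewrite add0r.
have dfg : differentiable (f \o g) t.
  by apply: differentiable_comp; [exact: ex_diff|exact: df].
apply: DeriveDef; first exact: diff_derivable.
have dgt : differentiable g t by [].
by rewrite deriveE// (diff_comp dgt (df _))/= diff_val scale1r diff_grad.
Qed.

(** One mean value inequality serves all the estimates along segments:
    with b = 0 it bounds first-order remainders, and the linear part b of the
    derivative accounts for the term b / 2 of a second-order expansion. *)
Lemma mean_value_quadratic (phi dphi : R -> R) (a b K : R) :
  (forall t : R, is_derive t 1 phi (dphi t)) ->
  (forall t, 0 <= t <= 1 -> `|dphi t - a - b * t| <= K) ->
  `|phi 1 - phi 0 - a - 2^-1 * b| <= K.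
Proof.
move=> dp pK.
pose psi := fun t : R => phi t - a * t - 2^-1 * b * t ^+ 2.
have dpsi (t : R) : is_derive t 1 psi (dphi t - a - b * t).
  rewrite /psi; have := dp t => dpt.
  apply: is_derive_eq.
  by rewrite /GRing.scale/=; lra.
have cpsi : {within `[0, 1], continuous psi}.
  apply: derivable_within_continuous => t _.
  exact: (@ex_derive _ _ _ _ _ _ _ (dpsi t)).
have [c c01] := MVT_segment ler01 (fun t _ => dpsi t) cpsi.
rewrite subr0 mulr1 => psiE.
have -> : phi 1 - phi 0 - a - 2^-1 * b = psi 1 - psi 0.
  by rewrite /psi; lra.
by rewrite psiE pK//; move: c01; rewrite in_itv.
Qed.

Definition second_order f z (a : 'cV[R]_d) (M : 'M[R]_d) :=
  forall e, 0 < e -> exists2 r, 0 < r & forall y, `|y - z| < r ->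
    `|f y - f z - dot a (y - z) - 2^-1 * dot (y - z) (M *m (y - z))|
      <= e * `|y - z| ^+ 2.

Lemma norm_segment u (t : R) : 0 <= t <= 1 -> `|t *: u| <= `|u|.
Proof.
by case/andP=> t0 t1; rewrite normrZ ger0_norm// ler_piMl.
Qed.

(** Along the segment from z to y = z + u the derivative of f is
    grad f (z + t u).u, which differs from grad f z.u + t (hess f z u).u by
    o(|u|^2) since the gradient is differentiable at z. *)
Lemma taylor2 f z : (forall y, differentiable f y) ->
  differentiable (grad f) z -> second_order f z (grad f z) (hess f z).
Proof.
move=> df dgf e e0.
(* The factor d.+1 absorbs the dimension in dot_le, including d = 0. *)
have d0 : 0 < e / d.+1%:R by rewrite divr_gt0.
have [r r0 H] := diff_bound dgf d0.
exists r => // y yz; set u := y - z.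
have := @mean_value_quadratic (fun s => f (z + s *: u))
  (fun t => dot (grad f (z + t *: u)) u) (dot (grad f z) u)
  (dot u (hess f z *m u)) (e * `|u| ^+ 2).
rewrite scale1r scale0r addr0 {1}/u subrKC; apply=> [t|t t01].
  exact: is_derive_line.
have tu := norm_segment u t01.
have := H (z + t *: u); rewrite addrAC subrr add0r => /(_ (le_lt_trans tu yz)).
rewrite diff_gradient_map// => Ht.
rewrite [dot u _]dotC mulrC -dotZl -!dotBl scalemxAr.
apply: (le_trans (dot_le _ _)).
apply: (@le_trans _ _ (d%:R * (e / d.+1%:R * `|u| * `|u|))).
  by rewrite ler_wpM2l// ler_wpM2r// (le_trans Ht)// ler_wpM2l// ltW.
rewrite -mulrA -expr2 mulrA ler_wpM2r ?sqr_ge0// mulrCA.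
by rewrite ler_piMr ?ltW// ltr_pdivrMr// mul1r ltr_nat.
Qed.

(** Both points vary, as a contraction argument requires; continuity keeps the
    gradient close to grad f z on the whole segment between them. *)
Lemma strict_differentiability f z e : (forall y, differentiable f y) ->
  {for z, continuous (grad f)} -> 0 < e ->
  exists2 r, 0 < r & forall x y, `|x - z| < r -> `|y - z| < r ->
    `|f x - f y - dot (grad f z) (x - y)| <= e * `|x - y|.
Proof.
move=> df cgf e0.
have d0 : 0 < e / d.+1%:R by rewrite divr_gt0.
have /nearP_dist[r r0 H] :
    \forall y \near z, `|grad f z - grad f y| < e / d.+1%:R.
  by move/cvgrPdist_lt : cgf; exact.
exists r => // x y xz yz; set u := x - y.
have := @mean_value_quadratic (fun s => f (y + s *: u))
  (fun t => dot (grad f (y + t *: u)) u) (dot (grad f z) u) 0 (e * `|u|).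
rewrite scale1r scale0r addr0 mulr0 subr0 {1}/u subrKC; apply=> [t|t t01].
  exact: is_derive_line.
have /H : `|y + t *: u - z| < r.
  have -> : y + t *: u - z = t *: (x - z) + (1 - t) *: (y - z).
    by apply/colP => i; rewrite !mxE; lra.
  rewrite (le_lt_trans (ler_normD _ _))// !normrZ.
  case/andP : t01 => t0 t1; rewrite ger0_norm// ger0_norm ?subr_ge0//.
  have : t * `|x - z| <= t * r by rewrite ler_wpM2l// ltW.
  have [->|t10] := eqVneq t 1; first by rewrite subrr mul0r addr0 !mul1r.
  have : (1 - t) * `|y - z| < (1 - t) * r.
    by rewrite ltr_pM2l// subr_gt0 lt_neqAle t10.
  lra.
rewrite distrC => /ltW Ht; rewrite mul0r subr0 -dotBl.
apply: (le_trans (dot_le _ _)).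
apply: (@le_trans _ _ (d%:R * (e / d.+1%:R * `|u|))).
  by rewrite ler_wpM2l// ler_wpM2r.
rewrite mulrA ler_wpM2r// mulrCA.
by rewrite ler_piMr ?ltW// ltr_pdivrMr// mul1r ltr_nat.
Qed.

(** The mean value inequality in the direction u for the increment of f in the
    direction v.  The second difference is symmetric in u and v, whence the
    symmetry of the Hessian. *)
Lemma second_difference f z u v e : (forall y, differentiable f y) ->
  differentiable (grad f) z -> 0 < e ->
  exists2 r, 0 < r & forall s, 0 < s < r ->
    `|f (z + s *: u + s *: v) - f (z + s *: v) - f (z + s *: u) + f z
      - s ^+ 2 * dot u (hess f z *m v)| <= e * s ^+ 2.
Proof.
move=> df dgf e0.
(* K collects the coefficients of e * s ^+ 2 that come up at the end. *)
pose K := d%:R * ((`|u| + `|v|) + `|u|) * `|u| + 1.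
have K0 : 0 < K by rewrite ltr_wpDl// !mulr_ge0// !addr_ge0.
have [r r0 H] := diff_bound dgf (divr_gt0 e0 K0).
have uv0 : 0 < `|u| + `|v| + 1 by rewrite ltr_wpDl// addr_ge0.
exists (r / (`|u| + `|v| + 1)) => [|s /andP[s0 sr]]; first exact: divr_gt0.
pose phi := fun t => f (z + s *: v + t *: (s *: u)) - f (z + t *: (s *: u)).
have := @mean_value_quadratic phi
  (fun t => dot (grad f (z + s *: v + t *: (s *: u)) -
                 grad f (z + t *: (s *: u))) (s *: u))
  (s ^+ 2 * dot u (hess f z *m v)) 0 (e * s ^+ 2).
rewrite /phi !scale1r !scale0r !addr0 mulr0 subr0.
have -> : f (z + s *: v + s *: u) - f (z + s *: u) - (f (z + s *: v) - f z) =
  f (z + s *: u + s *: v) - f (z + s *: v) - f (z + s *: u) + f z.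
  by rewrite (addrAC z); lra.
apply=> [t|t t01].
  rewrite dotBl.
  have := @is_derive_line f (z + s *: v) (s *: u) t df.
  have := @is_derive_line f z (s *: u) t df => h1 h2.
  exact: is_deriveB.
rewrite mul0r subr0.
have tu := norm_segment (s *: u) t01.
have su : `|s *: u| = s * `|u| by rewrite normrZ gtr0_norm.
have sv : `|s *: v| = s * `|v| by rewrite normrZ gtr0_norm.
have suv : s * (`|u| + `|v|) < r.
  rewrite ltr_pdivlMr// in sr; apply: le_lt_trans sr.
  by rewrite ler_pM2l// lerDl.
set b := t *: (s *: u) in tu *.
set c := s *: v in sv *.
have bc : `|c + b| <= s * (`|u| + `|v|).
  rewrite (le_trans (ler_normD _ _))// sv mulrDr addrC lerD//.
  by rewrite (le_trans tu)// su.
have bb : `|b| <= s * `|u| by rewrite (le_trans tu)// su.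
have := H (z + c + b); rewrite -(addrA z c b) [z + _ - z]addrAC subrr add0r.
move=> /(_ (le_lt_trans bc suv)) H1.
have := H (z + b); rewrite [z + _ - z]addrAC subrr add0r.
have bs : `|b| <= s * (`|u| + `|v|).
  by rewrite (le_trans bb)// ler_pM2l// lerDl.
move=> /(_ (le_lt_trans bs suv)) H2.
rewrite !diff_gradient_map// in H1 H2.
have -> : s ^+ 2 * dot u (hess f z *m v) = dot (hess f z *m c) (s *: u).
  by rewrite /c -scalemxAr dotZl dotZr dotC mulrA -expr2.
rewrite -dotBl (le_trans (dot_le _ _))// su.
have H3 : `|grad f (z + (c + b)) - grad f (z + b) - hess f z *m c| <=
   e / K * (s * (`|u| + `|v|)) + e / K * (s * `|u|).
  have -> : grad f (z + (c + b)) - grad f (z + b) - hess f z *m c =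
    (grad f (z + (c + b)) - grad f z - hess f z *m (c + b)) -
    (grad f (z + b) - grad f z - hess f z *m b).
    by rewrite mulmxDr; apply/colP => i; rewrite !mxE; lra.
  have eK0 : 0 < e / K by exact: divr_gt0.
  rewrite (le_trans (ler_normB _ _))// lerD//.
    by rewrite (le_trans H1)// ler_pM2l.
  by rewrite (le_trans H2)// ler_pM2l.
apply: (@le_trans _ _ (d%:R *
   ((e / K * (s * (`|u| + `|v|)) + e / K * (s * `|u|)) * (s * `|u|)))).
  by rewrite ler_wpM2l// ler_wpM2r// mulr_ge0// ltW.
have -> : d%:R *
   ((e / K * (s * (`|u| + `|v|)) + e / K * (s * `|u|)) * (s * `|u|)) =
   (e * s ^+ 2) * ((K - 1) / K) by rewrite /K; ring.
rewrite ler_piMr//; first by rewrite mulr_ge0// ?sqr_ge0// ltW.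
by rewrite ler_pdivrMr// mul1r gerBl.
Qed.

Lemma hess_dotC f z u v : (forall y, differentiable f y) ->
  differentiable (grad f) z ->
  dot u (hess f z *m v) = dot v (hess f z *m u).
Proof.
move=> df dgf; apply/eqP; rewrite -subr_eq0 -normr_le0.
apply/ler_addgt0Pl => e e0; rewrite addr0.
have e20 : 0 < e / 2 by rewrite divr_gt0.
have [r r0 H1] := second_difference u v df dgf e20.
have [r' r'0 H2] := second_difference v u df dgf e20.
pose s := Num.min r r' / 2.
have m0 : 0 < Num.min r r' by rewrite lt_min r0.
have s0 : 0 < s by rewrite divr_gt0.
have sm : s < Num.min r r' by rewrite /s ltr_pdivrMr// ltr_pMr// ltr1n.
move: sm; rewrite lt_min => /andP[sr sr'].
have := H1 s; rewrite s0 sr => /(_ isT) h1.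
have := H2 s; rewrite s0 sr' => /(_ isT) h2.
rewrite (addrAC z) in h2.
have s20 : 0 < s ^+ 2 by rewrite exprn_gt0.
rewrite -(ler_pM2l s20) -{1}(gtr0_norm s20) -normrM.
move: h1 h2; rewrite !ler_norml; set A := f _; set B := f _; set C := f _.
by move=> /andP[? ?] /andP[? ?]; apply/andP; split; lra.
Qed.

Lemma hess_sym f z : (forall y, differentiable f y) ->
  differentiable (grad f) z -> (hess f z)^T = hess f z.
Proof.
move=> df dgf; apply/matrixP => i k; rewrite mxE.
have E a b : dot (delta_mx a 0) (hess f z *m delta_mx b 0) = hess f z a b.
  rewrite dotE (bigD1 a)//= big1 => [|l la]; last first.
    by rewrite mxE (negbTE la) mul0r.
  by rewrite mxE !eqxx mul1r -colE addr0 mxE.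
by rewrite -!E hess_dotC.
Qed.

End Calculus.

(** * Positivity on a kernel and quadratic penalties *)

Section Coercivity.
Variables (R : realType) (d r : nat).
Implicit Types (u : 'cV[R]_d).

Lemma quad_continuous (H : 'M[R]_d) :
  continuous (fun u : 'cV[R]_d => dot u (H *m u)).
Proof.
apply: dot_continuous; last exact: mulmx_continuous.
by move=> u; exact: cvg_id.
Qed.

Lemma compact_argmin (K : set 'cV[R]_d) (f : 'cV[R]_d -> R) :
  compact K -> K !=set0 -> continuous f ->
  exists2 x, K x & forall y, K y -> f x <= f y.
Proof.
move=> cK K0 cf.
have [x xK xmin] := compact_EVT_min K0 cK (continuous_subspaceT cf).
by exists x => [|y Ky]; [move: xK; rewrite inE|apply: xmin; rewrite inE].
Qed.

Lemma quad_scale (H : 'M[R]_d) (k : R) u :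
  dot (k *: u) (H *m (k *: u)) = k ^+ 2 * dot u (H *m u).
Proof. by rewrite -scalemxAr dotZl dotZr mulrA expr2. Qed.

Lemma sphere_compact : compact [set u : 'cV[R]_d | `|u| = 1].
Proof.
apply: (@cV_bounded_closed_compact _ _ _ 1) => [z ->//|].
have := @closed_comp _ _ (fun u : 'cV[R]_d => `|u|) [set 1 : R].
by apply=> [u _|]; [exact: norm_continuous|exact: closed_eq].
Qed.

(** On the compact part of the unit sphere where u.H u <= 0 the quantity |A u|
    is bounded below by a positive number, so a large rho makes the sum
    positive on the whole sphere; its minimum there is kappa. *)
Lemma finsler (H : 'M[R]_d) (A : 'M[R]_(r, d)) :
  (forall u, A *m u = 0 -> u != 0 -> 0 < dot u (H *m u)) ->
  exists rho kappa : R, [/\ 0 <= rho, 0 < kappa &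
    forall u, kappa * `|u| ^+ 2 <= dot u (H *m u) + rho * `|A *m u| ^+ 2].
Proof.
move=> Hpos.
pose S := [set u : 'cV[R]_d | `|u| = 1].
have cA : continuous (fun u : 'cV[R]_d => `|A *m u|).
  move=> u; apply: (@continuous_comp _ _ _ (fun u => A *m u) (fun v => `|v|)).
    exact: mulmx_continuous.
  exact: norm_continuous.
have cq := @quad_continuous H.
have [rho rho0 Srho] : exists2 rho, 0 <= rho & forall u, S u ->
    0 < dot u (H *m u) + rho * `|A *m u| ^+ 2.
  pose K := S `&` [set u | dot u (H *m u) <= 0].
  have cK : compact K.
    apply: compact_closedI; first exact: sphere_compact.
    have := @closed_comp _ _ (fun u => dot u (H *m u)) [set x : R | x <= 0].
    by apply=> [u _|]; [exact: cq|exact: closed_le].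
  have [[k0 Kk0]|K0] := pselect (K !=set0); last first.
    exists 0 => // u Su; rewrite mul0r addr0 ltNge; apply/negP => u0.
    by apply: K0; exists u.
  have Kne : K !=set0 by exists k0.
  have [x [Sx x0] xmin] := compact_argmin cK Kne cA.
  have [y Ky ymin] := compact_argmin cK Kne cq.
  have Ax0 : 0 < `|A *m x|.
    rewrite normr_gt0; apply/eqP => Ax.
    have xN0 : x != 0.
      apply/eqP => x0'; move: Sx; rewrite /S/= x0' normr0 => /eqP.
      by rewrite eq_sym oner_eq0.
    by have := Hpos x Ax xN0; rewrite ltNge => /negP; apply.
  have a20 : 0 < `|A *m x| ^+ 2 by rewrite exprn_gt0.
  have q0 : 0 <= (`|dot y (H *m y)| + 1) / `|A *m x| ^+ 2.
    by rewrite divr_ge0// ?addr_ge0// ltW.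
  exists ((`|dot y (H *m y)| + 1) / `|A *m x| ^+ 2) => // u Su.
  have [u0|u0] := leP (dot u (H *m u)) 0; last first.
    by rewrite (lt_le_trans u0)// lerDl mulr_ge0// sqr_ge0.
  have Ku : K u by [].
  have h1 : `|dot y (H *m y)| + 1 <=
      (`|dot y (H *m y)| + 1) / `|A *m x| ^+ 2 * `|A *m u| ^+ 2.
    rewrite -mulrA ler_peMr ?addr_ge0// mulrC ler_pdivlMr// mul1r.
    by rewrite ler_sqr ?nnegrE// xmin.
  have h2 := ymin u Ku.
  have h3 : - `|dot y (H *m y)| <= dot y (H *m y).
    by rewrite lerNl ler_normr lexx orbT.
  by lra.
exists rho.
(* In dimension 0 the sphere is empty and kappa is arbitrary. *)
have [[s0 Ss0]|S0] := pselect (S !=set0); last first.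
  exists 1; split=> // u.
  have -> : u = 0.
    apply/eqP; apply: contrapT => /negP u0; apply: S0.
    exists (`|u|^-1 *: u).
    by rewrite /S/= normrZ normfV normr_id mulVf// normr_eq0.
  by rewrite !mulmx0 dot0r !normr0 expr0n/= !mulr0 addr0.
have cf : continuous (fun u => dot u (H *m u) + rho * `|A *m u| ^+ 2).
  move=> u; apply: (cvgD (cq u)); apply: cvgM; first exact: cvg_cst.
  exact: (cvgM (cA u) (cA u)).
have Sne : S !=set0 by exists s0.
have [x Sx xmin] := compact_argmin sphere_compact Sne cf.
exists (dot x (H *m x) + rho * `|A *m x| ^+ 2); split=> //; first exact: Srho.
move=> u; have [->|u0] := eqVneq u 0.
  by rewrite !mulmx0 dot0r !normr0 expr0n/= !mulr0 addr0.
have nu0 : 0 < `|u| by rewrite normr_gt0.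
have Sk : S (`|u|^-1 *: u).
  by rewrite /S/= normrZ normfV normr_id mulVf// normr_eq0.
have := xmin _ Sk.
rewrite quad_scale -scalemxAr normrZ normfV normr_id.
set D := dot u _; set a := `|A *m u|.
have -> : `|u|^-1 ^+ 2 * D + rho * (`|u|^-1 * a) ^+ 2 =
    (D + rho * a ^+ 2) / `|u| ^+ 2 by field; rewrite gt_eqF.
by rewrite ler_pdivlMr// exprn_gt0.
Qed.

End Coercivity.

(** * Correcting an approximate solution of a system of equations *)

(** Joins completeness with the norm of matrices, so that the Banach
    fixed-point theorem applies to column vectors. *)
HB.instance Definition _ (R : realType) (m n : nat) :=
  Uniform_isComplete.Build 'M[R]_(m, n) cauchy_cvg.

Section Correction.
Variables (R : realType) (d r : nat).
Implicit Types (u : 'cV[R]_d).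

Lemma contraction_fixed_point (T : 'cV[R]_r -> 'cV[R]_r) (rho : R) :
  0 <= rho ->
  (forall w, `|w| <= rho -> `|T w| <= rho) ->
  (forall w w', `|w| <= rho -> `|w'| <= rho ->
    `|T w - T w'| <= 2^-1 * `|w - w'|) ->
  exists2 w, `|w| <= rho & T w = w.
Proof.
move=> rho0 Tin Tc.
pose U := [set w : 'cV[R]_r | `|w| <= rho].
have TU : set_fun U U T by move=> w; exact: Tin.
pose T' : {fun U >-> U} := mkfun_fun TU.
have ctr : is_contraction T'.
  exists (2^-1)%:nng; split=> /=; first by lra.
  by move=> [w w'] [/= Uw Uw']; exact: Tc.
have clU : closed U.
  have := @closed_comp _ _ (fun u : 'cV[R]_r => `|u|) [set x : R | x <= rho].
  by apply=> [u _|]; [exact: norm_continuous|exact: closed_le].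
have [|w Uw wE] := banach_fixed_point ctr clU.
  by exists 0; rewrite /U/= normr0.
by exists w.
Qed.

(** The point sought is z0 + t u + B w, where w solves
    hS (z0 + t u + B w) = 0.  As hS is nearly A near z0 and A B = 1, the map
    w |-> w - hS (z0 + t u + B w) contracts by 1/2; it moves 0 by
    |hS (z0 + t u)| = o(t) since A u = 0, so its fixed point is o(t). *)
Lemma feasible_correction (hS : 'cV[R]_d -> 'cV[R]_r) (A : 'M[R]_(r, d))
    (B : 'M[R]_(d, r)) (z0 u : 'cV[R]_d) :
  (forall e, 0 < e -> exists2 p, 0 < p & forall x y,
     `|x - z0| < p -> `|y - z0| < p ->
     `|hS x - hS y - A *m (x - y)| <= e * `|x - y|) ->
  A *m B = 1%:M -> A *m u = 0 -> hS z0 = 0 ->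
  forall e, 0 < e -> exists2 tau, 0 < tau & forall t, 0 < t < tau ->
    exists2 z, hS z = 0 & `|z - z0 - t *: u| <= e * t.
Proof.
move=> strict AB Au h0 e e0.
have [C C0 BC] := mulmx_le B.
(* (2 * C)^-1 makes the map a contraction of ratio 1/2, and e2 makes it move 0
   by at most half of the radius rho chosen for B w to have size e * t. *)
have C20 : 0 < (2 * C)^-1 by rewrite invr_gt0 mulr_gt0.
have u10 : 0 < `|u| + 1 by rewrite ltr_wpDl.
pose e2 := e / (2 * C * (`|u| + 1)).
have e20 : 0 < e2 by rewrite divr_gt0// mulr_gt0// mulr_gt0.
have [p1 p10 s1] := strict _ C20.
have [p2 p20 s2] := strict _ e20.
pose p := Num.min p1 p2.
have p0 : 0 < p by rewrite lt_min p10.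
have eu0 : 0 < `|u| + e by rewrite ltr_wpDl.
exists (p / (`|u| + e)) => [|t /andP[t0 tp]]; first exact: divr_gt0.
have tpu : t * (`|u| + e) < p by rewrite -ltr_pdivlMr.
pose T (w : 'cV[R]_r) := w - hS (z0 + t *: u + B *m w).
pose rho := e * t / C.
have rho0 : 0 <= rho by rewrite divr_ge0 ?mulr_ge0// ltW.
have dE (w : 'cV[R]_r) : z0 + t *: u + B *m w - z0 = t *: u + B *m w.
  by apply/colP => i; rewrite !mxE; ring.
have Brho (w : 'cV[R]_r) : `|w| <= rho -> `|B *m w| <= e * t.
  move=> wrho; rewrite (le_trans (BC w))//.
  by move: wrho; rewrite /rho ler_pdivlMr// mulrC.
have inp (w : 'cV[R]_r) : `|w| <= rho -> `|z0 + t *: u + B *m w - z0| < p.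
  move=> wrho; apply: le_lt_trans tpu; rewrite dE.
  rewrite (le_trans (ler_normD _ _))// normrZ gtr0_norm// mulrDr lerD2l.
  by rewrite (le_trans (Brho _ wrho))// mulrC.
have Tc (w w' : 'cV[R]_r) : `|w| <= rho -> `|w'| <= rho ->
    `|T w - T w'| <= 2^-1 * `|w - w'|.
  move=> wr wr'.
  have := s1 (z0 + t *: u + B *m w) (z0 + t *: u + B *m w').
  have := inp _ wr; rewrite lt_min => /andP[h1 _].
  have := inp _ wr'; rewrite lt_min => /andP[h2 _] /(_ h1 h2).
  have -> : z0 + t *: u + B *m w - (z0 + t *: u + B *m w') = B *m (w - w').
    by rewrite mulmxBr; apply/colP => i; rewrite !mxE; ring.
  rewrite mulmxA AB mul1mx -normrN.
  set X := - _; have -> : X = T w - T w'.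
    by rewrite /X /T; apply/colP => i; rewrite !mxE; ring.
  move=> /le_trans; apply; rewrite invfM -mulrA ler_pM2l ?invr_gt0//.
  by rewrite ler_pdivrMl.
have n0 : `|0 : 'cV[R]_r| <= rho by rewrite normr0.
have T0 : `|T 0| <= rho / 2.
  have := s2 (z0 + t *: u + B *m 0) z0.
  have := inp _ n0; rewrite lt_min => /andP[_ h1].
  rewrite subrr normr0 => /(_ h1 p20).
  rewrite h0 subr0 dE mulmx0 !addr0 -scalemxAr Au scaler0 subr0.
  rewrite /T mulmx0 addr0 sub0r normrN => /le_trans; apply.
  rewrite normrZ gtr0_norm// /e2 /rho.
  have -> : e / (2 * C * (`|u| + 1)) * (t * `|u|) =
    (e * t / C / 2) * (`|u| / (`|u| + 1)).
    by field; rewrite !gt_eqF.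
  rewrite ler_piMr//; last by rewrite ler_pdivrMr// mul1r lerDl.
  by rewrite !divr_ge0 ?mulr_ge0 ?ltW.
have [|w wr Tw] := @contraction_fixed_point T rho rho0 _ Tc.
  move=> w wr; have -> : T w = T 0 + (T w - T 0) by rewrite addrC subrK.
  rewrite (le_trans (ler_normD _ _))//.
  have := Tc _ _ wr n0; rewrite subr0 => h.
  by lra.
exists (z0 + t *: u + B *m w).
  move/eqP: Tw; rewrite /T -subr_eq0 addrAC subrr add0r oppr_eq0.
  by move/eqP.
suff -> : z0 + t *: u + B *m w - z0 - t *: u = B *m w by exact: Brho.
by apply/colP => i; rewrite !mxE; ring.
Qed.

End Correction.

(** * Growth of the perturbed objective around the predicted point *)

Section Growth.
Variables (R : realType) (d r : nat).
Implicit Types (u z : 'cV[R]_d).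
Variables (H : 'M[R]_d) (A : 'M[R]_(r, d)) (g dz : 'cV[R]_d) (xi : 'cV[R]_r).
Hypothesis H_sym : H^T = H.
Hypothesis stationary : H *m dz + A^T *m xi = - g.
Hypothesis tangent : A *m dz = 0.

Definition first_order n (f : 'cV[R]_d -> 'cV[R]_n) z0 (J : 'M[R]_(n, d)) :=
  forall e, 0 < e -> exists2 p, 0 < p & forall z, `|z - z0| < p ->
    `|f z - f z0 - J *m (z - z0)| <= e * `|z - z0|.

Definition first_order1 (f : 'cV[R]_d -> R) z0 (a : 'cV[R]_d) :=
  forall e, 0 < e -> exists2 p, 0 < p & forall z, `|z - z0| < p ->
    `|f z - f z0 - dot a (z - z0)| <= e * `|z - z0|.

(** The critical value of u |-> 1/2 u.H u + g.u on the kernel of A. *)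
Definition quad_model := 2^-1 * dot dz (H *m dz) + dot dz g.
Local Notation q := quad_model.

(** By stationarity the gradient H dz + g of the model at dz is - A^T xi, so
    recentring at t dz leaves no linear term except along the rows of A. *)
Lemma quad_shift (t : R) u :
  2^-1 * dot (t *: dz + u) (H *m (t *: dz + u)) + t * dot g (t *: dz + u) =
  t ^+ 2 * q + 2^-1 * dot u (H *m u) - t * dot xi (A *m u).
Proof.
have Hdu : dot dz (H *m u) = dot u (H *m dz) by rewrite dot_mulmx H_sym dotC.
have cross : dot u (H *m dz) = - dot g u - dot xi (A *m u).
  rewrite (dot_mulmx xi) [dot (_ *m _) u]dotC [dot g u]dotC -dotNr -dotBr.
  by rewrite -stationary addrK.
rewrite mulmxDr -scalemxAr !dotDl !dotDr !dotZl !dotZr Hdu cross.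
by rewrite /quad_model [dot dz g]dotC; field.
Qed.

Lemma split_displacement (t : R) u : t *: dz + (u - t *: dz) = u.
Proof. by rewrite addrC subrK. Qed.

(** Here L stands for the Lagrangian and G for the perturbation fj - f0. *)
Variables (f0 G L : 'cV[R]_d -> R) (z0 : 'cV[R]_d) (Z : set 'cV[R]_d).
Hypothesis L_expand : second_order L z0 0 H.
Hypothesis G_expand : first_order1 G z0 g.
Hypothesis L0 : L z0 = f0 z0.

(** With u = z - z0 - t dz, D = |z - z0| and a = |hS z|, expanding L and G and
    applying [quad_shift] leaves kappa/2 |u|^2 + c a - rho a^2 - t K a up to
    errors e1 (t^2 + D^2); near z0 and for small t the middle terms are
    nonnegative, and D <= t |dz| + |u| splits the error between e t^2 and a
    fraction of kappa |u|^2. *)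
Lemma lower_growth (hS : 'cV[R]_d -> 'cV[R]_r) (c rho kappa : R) :
  first_order hS z0 A -> hS z0 = 0 ->
  0 < c -> (forall z, Z z -> L z + c * `|hS z| <= f0 z) ->
  0 <= rho -> 0 < kappa ->
  (forall u, kappa * `|u| ^+ 2 <= dot u (H *m u) + rho * `|A *m u| ^+ 2) ->
  forall e, 0 < e -> exists2 p, 0 < p & forall t z, 0 < t < p -> Z z ->
    `|z - z0| < p ->
    f0 z0 + t * G z0 + t ^+ 2 * q
      + kappa / 4 * `|z - z0 - t *: dz| ^+ 2 - e * t ^+ 2
    <= f0 z + t * G z.
Proof.
move=> hS_expand hS0 c0 pen rho0 kap0 coer e e0.
set M := `|dz|; have M0 : 0 <= M by exact: normr_ge0.
pose K := r%:R * `|xi|; have K0 : 0 <= K by rewrite mulr_ge0.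
(* P and Q are the coefficients that e1 * D ^+ 2 and e1 * t ^+ 2 receive in the
   total error: e1 * P <= kappa / 8 keeps half of kappa / 2, and e1 * Q <= e. *)
pose P := rho + K + 2; have P0 : 0 < P by rewrite /P; lra.
pose Q := 2 * P * M ^+ 2 + K + 1.
have Q0 : 0 < Q.
  have : 0 <= 2 * P * M ^+ 2 by rewrite !mulr_ge0 ?exprn_ge0// ltW.
  by rewrite /Q; lra.
pose e1 := Num.min 1 (Num.min (kappa / (8 * P)) (e / Q)).
have e10 : 0 < e1.
  by rewrite !lt_min ltr01 (divr_gt0 e0 Q0) andbT divr_gt0// mulr_gt0.
have e11 : e1 <= 1 by rewrite ge_min lexx.
have e1P : e1 * P <= kappa / 8.
  rewrite -ler_pdivlMr// -mulrA -invfM; apply: le_trans (lexx _).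
  by rewrite !ge_min lexx orbT.
have e1Q : e1 * Q <= e by rewrite -ler_pdivlMr// !ge_min lexx !orbT.
have [p1 p10 HL] := L_expand e10.
have [p2 p20 HG] := G_expand e10.
have [p3 p30 HS] := hS_expand _ e10.
have [C C0 AC] := mulmx_le A.
(* p4 ensures rho * a <= c / 2 and p5 ensures t * K <= c / 2. *)
pose p4 := c / (2 * (rho + 1) * (C + 1)).
pose p5 := c / (2 * (K + 1)).
have rho1 : 0 < rho + 1 by lra.
have K1 : 0 < K + 1 by lra.
have C1 : 0 < C + 1 by lra.
have p40 : 0 < p4 by rewrite divr_gt0// !mulr_gt0.
have p50 : 0 < p5 by rewrite divr_gt0// !mulr_gt0.
exists (Num.min p1 (Num.min p2 (Num.min p3 (Num.min p4 p5)))).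
  by rewrite !lt_min p10 p20 p30 p40 p50.
move=> t z /andP[t0]; rewrite !lt_min => /and5P[_ _ _ _ tp5] Zz.
set D := `|z - z0| => /and5P[Dp1 Dp2 Dp3 Dp4 _].
set u := z - z0 - t *: dz; set N := `|u|.
have D0 : 0 <= D by exact: normr_ge0.
have N0 : 0 <= N by exact: normr_ge0.
have DN : D <= t * M + N.
  rewrite /D -(split_displacement t (z - z0)) (le_trans (ler_normD _ _))//.
  by rewrite normrZ gtr0_norm.
have Au : A *m u = A *m (z - z0).
  by rewrite mulmxBr -scalemxAr tangent scaler0 subr0.
set a := `|hS z|; have a0 : 0 <= a by exact: normr_ge0.
have HSz := HS _ Dp3; rewrite hS0 subr0 -/D in HSz.
set y := `|A *m u|; have y0 : 0 <= y by exact: normr_ge0.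
have ya : y <= a + e1 * D.
  have -> : y = `|hS z - (hS z - A *m (z - z0))| by rewrite subKr /y Au.
  by rewrite (le_trans (ler_normB _ _))// lerD2l.
have aD : a <= (C + 1) * D.
  have -> : a = `|(hS z - A *m (z - z0)) + A *m (z - z0)| by rewrite subrK.
  rewrite (le_trans (ler_normD _ _))// addrC mulrDl lerD ?AC// mul1r.
  by rewrite (le_trans HSz)// ler_piMl.
have arho : rho * a <= c / 2.
  have : (C + 1) * D <= c / (2 * (rho + 1)).
    move: (ltW Dp4); rewrite /p4 invfM mulrA ler_pdivlMr//.
    by rewrite mulrC.
  move=> /(le_trans aD); rewrite invfM mulrA ler_pdivlMr// => h.
  by rewrite (le_trans _ h)// mulrDr mulr1 mulrC lerDl.
have tK : t * K <= c / 2.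
  move: (ltW tp5); rewrite /p5 invfM mulrA ler_pdivlMr// => h.
  by rewrite (le_trans _ h)// mulrDr mulr1 lerDl ltW.
have xiA : t * dot xi (A *m u) <= t * K * y.
  rewrite -mulrA ler_pM2l// /K -mulrA (le_trans (ler_norm _))//.
  exact: dot_le.
have := HL _ Dp1; rewrite L0 (dotC 0) dot0r subr0 -/D ler_norml => /andP[HLz _].
have := HG _ Dp2; rewrite -/D ler_norml => /andP[HGz _].
have pz := pen _ Zz; rewrite -/a in pz.
have qs := quad_shift t u; rewrite split_displacement in qs.
have co := coer u; rewrite -/N -/y in co.
have tGz : t * (- (e1 * D)) <= t * (G z - G z0 - dot g (z - z0)).
  by rewrite ler_pM2l.
have tt : t * D <= t ^+ 2 + D ^+ 2.
  have := sqr_ge0 (t - D); have := sqr_ge0 t; have := sqr_ge0 D.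
  by rewrite !expr2; nra.
have D2 : D ^+ 2 <= 2 * (t ^+ 2 * M ^+ 2) + 2 * N ^+ 2.
  rewrite -exprMn; apply: le_trans (_ : (t * M + N) ^+ 2 <= _).
    by rewrite ler_sqr ?nnegrE// addr_ge0// mulr_ge0// ltW.
  by have := sqr_ge0 (t * M - N); rewrite !expr2; nra.
have y2 : y ^+ 2 <= 2 * a ^+ 2 + 2 * (e1 ^+ 2 * D ^+ 2).
  rewrite -exprMn; apply: le_trans (_ : (a + e1 * D) ^+ 2 <= _).
    by rewrite ler_sqr ?nnegrE// addr_ge0// mulr_ge0// ltW.
  by have := sqr_ge0 (a - e1 * D); rewrite !expr2; nra.
have e12 : e1 ^+ 2 * D ^+ 2 <= e1 * D ^+ 2.
  by rewrite ler_wpM2r ?sqr_ge0// expr2 ler_piMl// ltW.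
have ry : rho * y ^+ 2 <= 2 * (rho * a) * a + 2 * (rho * (e1 * D ^+ 2)).
  apply: le_trans (ler_wpM2l rho0 y2) _.
  by have := ler_wpM2l rho0 e12; lra.
have ra : rho * a * a <= c / 2 * a by rewrite ler_wpM2r.
have tKy : t * K * y <= c / 2 * a + K * (e1 * (t * D)).
  apply: le_trans (_ : t * K * (a + e1 * D) <= _).
    by rewrite ler_wpM2l// mulr_ge0// ltW.
  rewrite mulrDr lerD//; first by rewrite ler_wpM2r.
  by rewrite le_eqVlt; apply/orP; left; apply/eqP; ring.
have ett : e1 * (t * D) <= e1 * (t ^+ 2 + D ^+ 2) by rewrite ler_pM2l.
have Kett : K * (e1 * (t * D)) <= K * (e1 * (t ^+ 2 + D ^+ 2)).
  by rewrite ler_wpM2l.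
have ePD : e1 * P * D ^+ 2 <= e1 * P * (2 * (t ^+ 2 * M ^+ 2) + 2 * N ^+ 2).
  by rewrite ler_wpM2l// mulr_ge0// ltW.
have ePN : e1 * P * N ^+ 2 <= kappa / 8 * N ^+ 2 by rewrite ler_wpM2r ?sqr_ge0.
have eQt : e1 * Q * t ^+ 2 <= e * t ^+ 2 by rewrite ler_wpM2r ?sqr_ge0.
move: ePD ePN eQt; rewrite /Q /P; lra.
Qed.

(** On the curve f0 = L, so the expansions of L and G with [quad_shift] give the
    model value, and every remaining term has a factor |z - z0 - t dz| or e1. *)
Lemma upper_growth :
  (forall e, 0 < e -> exists2 tau, 0 < tau & forall t, 0 < t < tau ->
     exists z, [/\ Z z, f0 z = L z & `|z - z0 - t *: dz| <= e * t]) ->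
  forall e, 0 < e -> exists2 tau, 0 < tau & forall t, 0 < t < tau ->
    exists2 z, Z z &
      f0 z + t * G z <= f0 z0 + t * G z0 + t ^+ 2 * q + e * t ^+ 2.
Proof.
move=> curve e e0.
set M := `|dz|; have M0 : 0 <= M by exact: normr_ge0.
have [K1 K10 HK1] := mulmx_le H.
have [K2 K20 HK2] := mulmx_le A.
pose B1 := d%:R * K1; have B10 : 0 <= B1 by rewrite mulr_ge0// ltW.
pose B2 := r%:R * `|xi| * K2; have B20 : 0 <= B2 by rewrite !mulr_ge0// ltW.
pose Q := B1 + B2 + (M + 1) ^+ 2 + (M + 1).
have Q0 : 0 < Q by rewrite /Q; have := sqr_ge0 (M + 1); lra.
pose e1 := Num.min 1 (e / Q).
have e10 : 0 < e1 by rewrite lt_min ltr01 divr_gt0.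
have e11 : e1 <= 1 by rewrite ge_min lexx.
have e1Q : e1 * Q <= e by rewrite -ler_pdivlMr// !ge_min lexx !orbT.
have [p1 p10 HL] := L_expand e10.
have [p2 p20 HG] := G_expand e10.
have [p3 p30 Hc] := curve _ e10.
have M1 : 0 < M + 1 by lra.
exists (Num.min (p1 / (M + 1)) (Num.min (p2 / (M + 1)) p3)).
  by rewrite !lt_min p30 !divr_gt0.
move=> t /andP[t0]; rewrite !lt_min => /and3P[tp1 tp2 tp3].
have [|z [Zz f0L]] := Hc t; first by rewrite t0.
set u := z - z0 - t *: dz; set N := `|u| => Ne1.
exists z => //.
set D := `|z - z0|.
have D0 : 0 <= D by exact: normr_ge0.
have N0 : 0 <= N by exact: normr_ge0.
have Nt : N <= t by rewrite (le_trans Ne1)// ler_piMl// ltW.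
have DN : D <= t * (M + 1).
  rewrite /D -(split_displacement t (z - z0)) (le_trans (ler_normD _ _))//.
  by rewrite normrZ gtr0_norm// mulrDr mulr1 lerD2l.
have Dp1 : D < p1 by rewrite (le_lt_trans DN)// -ltr_pdivlMr.
have Dp2 : D < p2 by rewrite (le_lt_trans DN)// -ltr_pdivlMr.
have := HL _ Dp1; rewrite L0 (dotC 0) dot0r subr0 -/D ler_norml => /andP[_ HLz].
have := HG _ Dp2; rewrite -/D ler_norml => /andP[_ HGz].
have qs := quad_shift t u; rewrite split_displacement in qs.
have uHu : dot u (H *m u) <= B1 * N ^+ 2.
  rewrite (le_trans (ler_norm _))// (le_trans (dot_le _ _))// -mulrA.
  by rewrite ler_wpM2l// mulrC expr2 mulrA ler_wpM2r// HK1.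
have xiA : - dot xi (A *m u) <= B2 * N.
  rewrite -dotNr (le_trans (ler_norm _))// (le_trans (dot_le _ _))//.
  by rewrite normrN -!mulrA !ler_wpM2l// HK2.
have txiA : t * (- dot xi (A *m u)) <= t * (B2 * N) by rewrite ler_pM2l.
have tBN : t * (B2 * N) <= t * (B2 * (e1 * t)) by rewrite ler_pM2l// ler_wpM2l.
have N2 : N ^+ 2 <= e1 * t ^+ 2.
  by rewrite !expr2 mulrA ler_pM.
have BN2 : B1 * N ^+ 2 <= B1 * (e1 * t ^+ 2) by rewrite ler_wpM2l.
have D2 : D ^+ 2 <= t ^+ 2 * (M + 1) ^+ 2.
  by rewrite -exprMn ler_sqr ?nnegrE// mulr_ge0// ltW.
have eD2 : e1 * D ^+ 2 <= e1 * (t ^+ 2 * (M + 1) ^+ 2) by rewrite ler_pM2l.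
have tG : t * (G z - G z0 - dot g (z - z0)) <= t * (e1 * D) by rewrite ler_pM2l.
have tD : t * (e1 * D) <= t * (e1 * (t * (M + 1))) by rewrite !ler_pM2l.
have eQt : e1 * Q * t ^+ 2 <= e * t ^+ 2 by rewrite ler_wpM2r ?sqr_ge0.
have B1e : 0 <= B1 * (e1 * t ^+ 2).
  by rewrite mulr_ge0// mulr_ge0 ?sqr_ge0// ltW.
rewrite f0L; move: eQt; rewrite /Q; lra.
Qed.

End Growth.

(** * Unique multipliers and the KKT matrix *)

Section Multipliers.
Variables (R : realType) (d m s : nat) (h : 'I_m -> 'cV[R]_d -> R).
Variables (f : 'cV[R]_d -> R) (z0 : 'cV[R]_d) (nu0 : 'cV[R]_m).
Local Notation act := (active_ineq s h z0).
Local Notation S := (eq_idx m s :|: act).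
Local Notation J := (active_jacobian s h z0).

Lemma multiplier_gap : (forall k, k \in act -> 0 < nu0 k 0) ->
  exists2 c, 0 < c & forall k, k \in act -> c <= nu0 k 0.
Proof.
move=> nu_pos; exists (\big[Num.min/1]_(k in act) nu0 k 0) => [|k kA].
  by elim/big_ind : _ => // x y x0 y0; rewrite lt_min x0.
by rewrite (bigD1 k)//= ge_min lexx.
Qed.

Lemma jacobian_mul (u : 'cV[R]_d) i :
  (J *m u) i 0 = dot (grad (h (enum_val i)) z0) u.
Proof. by rewrite mxE dotE; apply: eq_bigr => l _; rewrite mxE. Qed.

Lemma jacobian_tr_mul (x : 'cV[R]_#|S|) :
  J^T *m x = \sum_i x i 0 *: grad (h (enum_val i)) z0.
Proof.
apply/colP => l; rewrite mxE summxE; apply: eq_bigr => i _.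
by rewrite !mxE mulrC.
Qed.

Lemma kernel_critical (u : 'cV[R]_d) : J *m u = 0 -> critical_cone s h z0 u.
Proof.
move=> Ju k kS.
by rewrite -[k](enum_rankK_in kS kS) dotC -jacobian_mul Ju mxE.
Qed.

(** A relation mu between the active gradients makes nu0 + e mu satisfy the
    stationarity equation for every e.  Strict complementarity leaves room of
    size c below the active components of nu0, so for small e it is a
    multiplier again, and uniqueness forces mu = 0. *)
Lemma active_jacobian_row_free : unique (lagrange_multiplier s h f z0) nu0 ->
  (forall k, k \in act -> 0 < nu0 k 0) -> row_free J.
Proof.
move=> [[stat compl] uniq_nu] nu_pos.
have [c c0 cnu] := multiplier_gap nu_pos.
rewrite -kermx_eq0; apply/rowV0P => x /sub_kermxP xJ.
have {}xJ : \sum_i x 0 i *: grad (h (enum_val i)) z0 = 0.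
  have := jacobian_tr_mul x^T; rewrite -trmx_mul xJ trmx0 => E; rewrite [RHS]E.
  by apply: eq_bigr => i _; rewrite mxE.
pose mu : 'cV[R]_m := \col_k \sum_(i | enum_val i == k) x 0 i.
have mu_grad : \sum_k mu k 0 *: grad (h k) z0 = 0.
  rewrite -[RHS]xJ [RHS](partition_big (fun i => enum_val i) predT)//=.
  apply: eq_bigr => k _; rewrite mxE scaler_suml.
  by apply: eq_bigr => i /eqP <-.
have mu_out k : k \notin S -> mu k 0 = 0.
  move=> kS; rewrite mxE big1// => i /eqP ik.
  by move: kS; rewrite -ik enum_valP.
have m1 : 0 < `|mu| + 1 by rewrite ltr_wpDl.
pose e := c / (`|mu| + 1).
have e0 : 0 < e by rewrite divr_gt0.
have : lagrange_multiplier s h f z0 (nu0 + e *: mu).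
  split=> [|k sk].
    under eq_bigr do rewrite mxE [(e *: mu) _ _]mxE scalerDl -scalerA.
    by rewrite big_split/= -scaler_sumr mu_grad scaler0 addr0.
  have [nuk nukh] := compl k sk.
  rewrite mxE [(e *: mu) _ _]mxE.
  have [hk|hk] := eqVneq (h k z0) 0; last first.
    have -> : mu k 0 = 0.
      by apply: mu_out; rewrite !inE sk (negbTE hk) ltnNge sk.
    by rewrite mulr0 addr0.
  have kA : k \in act by rewrite inE sk hk eqxx.
  split; last by rewrite hk mulr0.
  have emu : `|e * mu k 0| <= c.
    rewrite normrM gtr0_norm// /e mulrAC ler_pdivrMr// ler_pM2l//.
    by rewrite (le_trans (mx_entry_le _ _ _))// lerDl.
  have := cnu k kA; move: emu; rewrite ler_norml => /andP[? _] ?.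
  by lra.
move=> /uniq_nu /eqP; rewrite -subr_eq0 opprD addrA subrr add0r oppr_eq0.
rewrite scaler_eq0 gt_eqF//= => /eqP mu0.
apply/rowP => i; rewrite mxE.
have := congr1 (fun w : 'cV[R]_m => w (enum_val i) 0) mu0.
rewrite !mxE (bigD1 i)//= big1 ?addr0// => l /andP[/eqP/enum_val_inj -> ].
by rewrite eqxx.
Qed.

Lemma unitmx_col n (M : 'M[R]_n) :
  (forall w : 'cV[R]_n, M *m w = 0 -> w = 0) -> M \in unitmx.
Proof.
move=> Minj; rewrite -unitmx_tr -row_free_unit -kermx_eq0.
apply/rowV0P => x /sub_kermxP xM.
apply: trmx_inj; rewrite trmx0; apply: Minj.
by have := congr1 trmx xM; rewrite trmx_mul trmxK trmx0.
Qed.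

Lemma kkt_mul (w : 'cV[R]_(d + #|S|)) :
  kkt_matrix s h f z0 nu0 *m w =
  col_mx (hess_lagrangian h f z0 nu0 *m usubmx w + J^T *m dsubmx w)
         (J *m usubmx w).
Proof. by rewrite -{1}(vsubmxK w) mul_block_col mul0mx addr0. Qed.

Lemma kkt_unit :
  (forall u, J *m u = 0 -> u != 0 ->
     0 < dot u (hess_lagrangian h f z0 nu0 *m u)) ->
  row_free J -> kkt_matrix s h f z0 nu0 \in unitmx.
Proof.
move=> Hpos Jfree; apply: unitmx_col => w; rewrite kkt_mul -[0]col_mx0.
move=> /eq_col_mx[e1 e2].
have u0 : usubmx w = 0.
  (* Pairing the first block with u kills the J^T term, as J u = 0. *)
  apply: contrapT => /eqP u0; have := Hpos _ e2 u0.
  have /eqP := congr1 (dot (usubmx w)) e1.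
  rewrite dotDr dot0r (dot_mulmx _ J^T) trmxK e2 (dotC 0) dot0r addr0.
  by move=> /eqP ->; rewrite ltxx.
move: e1; rewrite u0 mulmx0 add0r => e1.
have d0 : dsubmx w = 0.
  apply: trmx_inj; rewrite trmx0; apply: (row_free_inj Jfree).
  by have := congr1 trmx e1; rewrite trmx_mul trmxK trmx0 mul0mx.
by rewrite -(vsubmxK w) u0 d0 col_mx0.
Qed.

End Multipliers.

(** * Stability of minimizers *)

Section Stability.
Variables (R : realType) (d : nat).
Implicit Types (Z : set 'cV[R]_d).

Lemma feasible_closed m s (h : 'I_m -> 'cV[R]_d -> R) :
  (forall k, continuous (h k)) -> closed (feasible s h).
Proof.
move=> ch.
have -> : feasible s h =
  (\bigcap_(k in [set k : 'I_m | (k < s)%N]) (h k @^-1` [set 0])) `&`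
  (\bigcap_(k in [set k : 'I_m | (s <= k)%N]) (h k @^-1` [set x | x <= 0])).
  by apply/seteqP; split=> z [].
apply: closedI; apply: closed_bigI => k _.
  by apply: closed_comp; [move=> z _; exact: ch|exact: closed_eq].
by apply: closed_comp; [move=> z _; exact: ch|exact: closed_le].
Qed.

(** Minimizers of F t exist and lie in a fixed ball because of the uniformly
    bounded sublevel sets.  On the part K of the feasible set in that ball at
    distance at least p from z0, f0 exceeds f0 z0 by a positive gap, and t G
    varies too little for small t to close it. *)
Lemma argmin_stability Z (f0 G : 'cV[R]_d -> R) (z0 : 'cV[R]_d)
    (alpha t0 M : R) :
  let F := fun t z => f0 z + t * G z in
  closed Z -> continuous f0 -> continuous G ->
  argmin f0 Z = [set z0] ->
  0 < t0 ->
  (forall t, 0 <= t < t0 -> [set z | Z z /\ F t z <= alpha] !=set0) ->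
  (forall t, 0 <= t < t0 -> forall z, Z z -> F t z <= alpha -> `|z| <= M) ->
  forall p, 0 < p -> exists2 tau, 0 < tau & forall t, 0 < t < tau ->
    argmin (F t) Z !=set0 /\ forall z, argmin (F t) Z z -> `|z - z0| < p.
Proof.
move=> F clZ cf cG z0min t00 ne bd p p0.
have [Zz0 z0le] : argmin f0 Z z0 by rewrite z0min.
have cF t : continuous (F t).
  by move=> z; apply: (cvgD (cf z)); apply: cvgM; [exact: cvg_cst|exact: cG].
have attained t : 0 <= t < t0 -> exists2 x, argmin (F t) Z x & F t x <= alpha.
  move=> tt0.
  have cS : compact [set z | Z z /\ F t z <= alpha].
    apply: (@cV_bounded_closed_compact _ _ _ M) => [z [Zz za]|].
      exact: (bd t).
    apply: (@closedI _ Z [set z | F t z <= alpha]) => //.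
    have := @closed_comp _ _ (F t) [set x : R | x <= alpha].
    by apply=> [z _|]; [exact: cF|exact: closed_le].
  have [x [Zx xa] xmin] := compact_argmin cS (ne t tt0) (cF t).
  exists x => //; split=> // w Zw.
  have [wa|aw] := leP (F t w) alpha; first exact: xmin.
  by rewrite (le_trans xa)// ltW.
pose K := [set z | (Z z /\ `|z| <= M) /\ p <= `|z - z0|].
have cn : continuous (fun z : 'cV[R]_d => `|z - z0|).
  apply: epsilon_continuous => z e e0; exists e => // w wz.
  by rewrite (le_trans (ler_dist_dist _ _))// opprB addrA subrK ltW.
have cK : compact K.
  apply: (@cV_bounded_closed_compact _ _ _ M) => [z [[]]//|].
  have -> : K = (Z `&` [set z | `|z| <= M]) `&` [set z | p <= `|z - z0|] by [].
  apply: closedI; first apply: closedI => //.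
    have := @closed_comp _ _ (fun z : 'cV[R]_d => `|z|) [set x : R | x <= M].
    by apply=> [z _|]; [exact: norm_continuous|exact: closed_le].
  have := @closed_comp _ _ (fun z : 'cV[R]_d => `|z - z0|) [set x : R | p <= x].
  by apply=> [z _|]; [exact: cn|exact: closed_ge].
have argminP t y : 0 < t < t0 -> argmin (F t) Z y -> p <= `|y - z0| -> K y.
  move=> /andP[tp tt0] [Zy ymin] py; split=> //; split=> //.
  have t01 : 0 <= t < t0 by rewrite ltW.
  have [x [Zx _] xa] := attained t t01.
  by apply: (bd t t01) => //; rewrite (le_trans (ymin _ Zx)).
have [Kne|K0] := pselect (K !=set0); last first.
  exists t0 => // t tt; split=> [|z zmin].
    by have [|x xm _] := attained t; [case/andP: tt => /ltW-> ->|exists x].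
  by rewrite ltNge; apply/negP => pz; apply: K0; exists z; exact: (argminP t).
have [k [[Zk kM] pk] kmin] := compact_argmin cK Kne cf.
have gap : 0 < f0 k - f0 z0.
  rewrite subr_gt0 ltNge; apply/negP => kz0.
  have : argmin f0 Z k by split=> // w Zw; rewrite (le_trans kz0)// z0le.
  rewrite z0min => /= kE; move: pk; rewrite kE subrr normr0 leNgt.
  by rewrite p0.
have [b Kb bmin] := compact_argmin cK Kne cG.
pose B := `|G b - G z0| + 1.
have B0 : 0 < B by rewrite ltr_wpDl.
exists (Num.min t0 ((f0 k - f0 z0) / B)).
  by rewrite lt_min t00 divr_gt0.
move=> t; rewrite lt_min => /and3P[tp tt0 tB]; split=> [|y ymin].
  by have [|x xm _] := attained t; [rewrite ltW|exists x].
rewrite ltNge; apply/negP => py.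
have Ky : K y by apply: (argminP t); rewrite ?tp.
have h1 := kmin _ Ky.
have h2 := bmin _ Ky.
have := ymin.2 _ Zz0; rewrite /F leNgt => /negP; apply.
move: tB; rewrite ltr_pdivlMr// => tB.
have h3 : - B <= G b - G z0.
  have : - `|G b - G z0| <= G b - G z0 by rewrite lerNl ler_normr lexx orbT.
  by rewrite /B; lra.
have h4 : t * (- B) <= t * (G y - G z0).
  by rewrite ler_pM2l// (le_trans h3)// lerD2r.
by lra.
Qed.

End Stability.

(** * Expansions of the Lagrangian and of the active constraints *)

Section Expansions.
Variables (R : realType) (d : nat).

Lemma common_radius (I : finType) (Q : I -> R -> Prop) :
  (forall i p p', 0 < p' -> p' <= p -> Q i p -> Q i p') ->
  (forall i, exists2 p, 0 < p & Q i p) ->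
  exists2 p, 0 < p & forall i, Q i p.
Proof.
move=> Qmono Qex.
pose p i := s2val (cid2 (Qex i)).
have p0 : 0 < \big[Num.min/1]_i p i.
  elim/big_ind : _ => // [x y x0 y0|i _]; first by rewrite lt_min x0.
  exact: (s2valP (cid2 (Qex i))).
exists (\big[Num.min/1]_i p i) => // i.
apply: Qmono (s2valP' (cid2 (Qex i))) => //.
by rewrite (bigD1 i)//= ge_min lexx.
Qed.

Lemma second_order0 (z : 'cV[R]_d) : second_order (fun=> 0) z 0 0.
Proof.
move=> e e0; exists 1 => // y _.
rewrite (dotC 0) !(mul0mx, dot0r, subr0, mulr0, normr0).
by rewrite mulr_ge0 ?sqr_ge0 ?ltW.
Qed.

Lemma second_orderD (f k : 'cV[R]_d -> R) z a b M N :
  second_order f z a M -> second_order k z b N ->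
  second_order (fun y => f y + k y) z (a + b) (M + N).
Proof.
move=> fe ke e e0; have e20 : 0 < e / 2 by rewrite divr_gt0.
have [p p0 Hp] := fe _ e20; have [p' p'0 Hp'] := ke _ e20.
exists (Num.min p p') => [|y]; first by rewrite lt_min p0.
rewrite lt_min => /andP[/Hp h1 /Hp' h2].
rewrite mulmxDl (dotDl _ a) (dotDr _ (M *m _)).
move: h1 h2; rewrite !ler_norml => /andP[? ?] /andP[? ?].
by apply/andP; split; lra.
Qed.

Lemma second_orderZ (f : 'cV[R]_d -> R) z a M (c : R) :
  second_order f z a M -> second_order (fun y => c * f y) z (c *: a) (c *: M).
Proof.
move=> fe e e0; have c0 : 0 < `|c| + 1 by rewrite ltr_wpDl.
have [p p0 Hp] := fe _ (divr_gt0 e0 c0).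
exists p => // y /Hp h1.
rewrite -scalemxAl dotZl dotZr.
set X := f y - _ - _ - _ in h1; set Y := (X in `|X|).
have -> : Y = c * X by rewrite /Y /X; ring.
rewrite normrM (le_trans (ler_wpM2l (normr_ge0 c) h1))//.
rewrite mulrA ler_wpM2r ?sqr_ge0// mulrCA ler_piMr ?ltW//.
by rewrite ltr_pdivrMr// mul1r ltrDl.
Qed.

Lemma second_order_sum (I : Type) (l : seq I) (f : I -> 'cV[R]_d -> R) z
    (a : I -> 'cV[R]_d) (M : I -> 'M[R]_d) (c : I -> R) :
  (forall i, second_order (f i) z (a i) (M i)) ->
  second_order (fun y => \sum_(i <- l) c i * f i y) z
    (\sum_(i <- l) c i *: a i) (\sum_(i <- l) c i *: M i).
Proof.
move=> fe; elim: l => [|i l IH].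
  under eq_fun do rewrite big_nil; rewrite !big_nil; exact: second_order0.
under eq_fun do rewrite big_cons; rewrite !big_cons.
by apply: second_orderD => //; exact: second_orderZ.
Qed.

Lemma differentiable_map_continuous (W : normedModType R)
    (f : 'cV[R]_d -> W) : (forall z, differentiable f z) -> continuous f.
Proof. by move=> df z; exact: differentiable_continuous. Qed.

Lemma first_order1_diff (f : 'cV[R]_d -> R) z :
  differentiable f z -> first_order1 f z (grad f z).
Proof.
move=> df e e0; have [p p0 H] := diff_bound df e0.
by exists p => // y yz; rewrite -diff_grad// H.
Qed.

Lemma first_order1B (f k : 'cV[R]_d -> R) z a b :
  first_order1 f z a -> first_order1 k z b ->
  first_order1 (fun y => f y - k y) z (a - b).
Proof.
move=> fe ke e e0; have e20 : 0 < e / 2 by rewrite divr_gt0.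
have [p p0 Hp] := fe _ e20; have [p' p'0 Hp'] := ke _ e20.
exists (Num.min p p') => [|y]; first by rewrite lt_min p0.
rewrite lt_min => /andP[/Hp h1 /Hp' h2].
rewrite dotBl.
move: h1 h2; rewrite !ler_norml => /andP[? ?] /andP[? ?].
by apply/andP; split; lra.
Qed.

End Expansions.

Section Sensitivity.
Variables (R : realType) (d m s : nat) (h : 'I_m -> 'cV[R]_d -> R).
Variables (f0 : 'cV[R]_d -> R) (z0 : 'cV[R]_d) (nu0 : 'cV[R]_m).
Hypothesis h_C2 : forall k, twice_continuously_differentiable (h k).
Hypothesis f0_C2 : twice_continuously_differentiable f0.
Hypothesis z0_feasible : feasible s h z0.
Hypothesis nu0_mult : lagrange_multiplier s h f0 z0 nu0.
Local Notation act := (active_ineq s h z0).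
Local Notation S := (eq_idx m s :|: act).
Local Notation J := (active_jacobian s h z0).
Local Notation H := (hess_lagrangian h f0 z0 nu0).

Definition lagrangian z := f0 z + \sum_k nu0 k 0 * h k z.

Definition active_map z : 'cV[R]_#|S| := \col_i h (enum_val i) z.

Lemma active_map0P z :
  active_map z = 0 <-> forall k, k \in S -> h k z = 0.
Proof.
split=> [hz k kS|hz].
  have := congr1 (fun w : 'cV[R]_#|S| => w (enum_rank_in kS k) 0) hz.
  by rewrite !mxE enum_rankK_in.
by apply/colP => i; rewrite !mxE hz// enum_valP.
Qed.

Lemma active_map_z0 : active_map z0 = 0.
Proof.
apply/active_map0P => k; rewrite !inE => /orP[ks|/andP[_ /eqP]//].
exact: z0_feasible.1.
Qed.

(** The other constraints have multiplier zero by complementarity. *)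
Lemma lagrangian_active z : active_map z = 0 -> f0 z = lagrangian z.
Proof.
move=> /active_map0P hz; rewrite /lagrangian big1 ?addr0// => k _.
have [kS|kS] := boolP (k \in S); first by rewrite hz// mulr0.
move: kS; rewrite !inE negb_or -leqNgt => /andP[sk]; rewrite sk/= => hk.
have /eqP := (nu0_mult.2 k sk).2.
by rewrite mulf_eq0 (negbTE hk) orbF => /eqP ->; rewrite mul0r.
Qed.

Lemma lagrangian_expansion : second_order lagrangian z0 0 H.
Proof.
have [stat _] := nu0_mult; rewrite -stat.
have [df0 dgf0 _] := f0_C2.
apply: second_orderD; first exact: taylor2.
by apply: second_order_sum => k; have [? ? _] := h_C2 k; exact: taylor2.
Qed.

Lemma hess_lagrangian_sym : H^T = H.
Proof.
have [df0 dgf0 _] := f0_C2.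
rewrite /hess_lagrangian linearD/= hess_sym// linear_sum; congr (_ + _).
apply: eq_bigr => k _; have [? ? _] := h_C2 k.
by rewrite linearZ/= hess_sym.
Qed.

(** On the feasible set every term nu0_k h_k is nonpositive, and an active
    inequality contributes at least c |h_k| to f0 - L; equality constraints
    contribute nothing to either side. *)
Lemma lagrangian_penalty : (forall k, k \in act -> 0 < nu0 k 0) ->
  exists2 c, 0 < c & forall z, feasible s h z ->
    lagrangian z + c * `|active_map z| <= f0 z.
Proof.
move=> nu_pos; have [c c0 cnu] := multiplier_gap nu_pos.
exists c => // z [heq hineq].
have terms k : 0 <= - (nu0 k 0 * h k z).
  have [ks|sk] := ltnP k s; first by rewrite heq// mulr0 oppr0.
  by rewrite -mulrN mulr_ge0 ?oppr_ge0 ?hineq//; have [] := nu0_mult.2 k sk.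
have sum_ge k : - (nu0 k 0 * h k z) <= - \sum_l nu0 l 0 * h l z.
  by rewrite -sumrN (bigD1 k)//= lerDl sumr_ge0.
have : `|active_map z| <= (- \sum_l nu0 l 0 * h l z) / c.
  have sum0 : 0 <= - \sum_l nu0 l 0 * h l z by rewrite -sumrN sumr_ge0.
  apply: mx_norm_le => [|i j]; first by rewrite divr_ge0// ltW.
  rewrite mxE ler_pdivlMr//; set k := enum_val i.
  have : k \in S by rewrite enum_valP.
  rewrite !inE => /orP[ks|kA].
    by rewrite heq// normr0 mul0r.
  apply: le_trans (sum_ge k).
  have sk : (s <= k)%N by case/andP : kA.
  have hk := hineq k sk.
  rewrite ler0_norm// mulrC -mulrN ler_wpM2r ?oppr_ge0//.
  by apply: cnu; rewrite inE.
by rewrite ler_pdivlMr// mulrC /lagrangian; lra.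
Qed.

Lemma active_map_strict e : 0 < e -> exists2 p, 0 < p & forall x y,
  `|x - z0| < p -> `|y - z0| < p ->
  `|active_map x - active_map y - J *m (x - y)| <= e * `|x - y|.
Proof.
move=> e0.
have [i p p' _ p'p Q x y xp yp| i |p p0 Hp] := @common_radius R _
  (fun (i : 'I_#|S|) p => forall x y, `|x - z0| < p -> `|y - z0| < p ->
    `|h (enum_val i) x - h (enum_val i) y
      - dot (grad (h (enum_val i)) z0) (x - y)| <= e * `|x - y|).
- by apply: Q; [exact: lt_le_trans p'p|exact: lt_le_trans p'p].
- have [dh dgh _] := h_C2 (enum_val i).
  by apply: strict_differentiability => //; exact: differentiable_continuous.
exists p => // x y xp yp; apply: mx_norm_le => [|i j].
  by rewrite mulr_ge0// ltW.
rewrite ord1 !mxE; have := Hp i x y xp yp.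
by rewrite -jacobian_mul mxE.
Qed.

Lemma inactive_slack : exists2 p, 0 < p & forall z, `|z - z0| < p ->
  forall k, k \notin S -> h k z <= 0.
Proof.
have [k p p' _ p'p Q kS z zp|k|p p0 Hp] := @common_radius R _
  (fun (k : 'I_m) p => k \notin S -> forall z, `|z - z0| < p -> h k z <= 0).
- by apply: Q => //; exact: lt_le_trans p'p.
- have [kS|kS] := boolP (k \in S); first by exists 1 => // /negP; rewrite kS.
  have hk : 0 < - h k z0.
    move: kS; rewrite !inE negb_or -leqNgt => /andP[sk]; rewrite sk/= => hk.
    by rewrite oppr_gt0 lt_neqAle hk z0_feasible.2.
  have [dh _ _] := h_C2 k.
  have [p p0 Hp] := continuous_dist z0 (differentiable_map_continuous dh) hk.
  exists p => // _ z /Hp; rewrite ltr_norml => /andP[_].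
  by rewrite ltrBlDr addNr => /ltW.
by exists p => // z zp k kS; exact: Hp.
Qed.

Lemma feasible_curve (u : 'cV[R]_d) : row_free J -> J *m u = 0 ->
  forall e, 0 < e -> exists2 tau, 0 < tau & forall t, 0 < t < tau ->
    exists z, [/\ feasible s h z, f0 z = lagrangian z &
      `|z - z0 - t *: u| <= e * t].
Proof.
move=> /row_freeP[B JB] Ju e e0.
have [tau tau0 Htau] :=
  feasible_correction active_map_strict JB Ju active_map_z0 e0.
have [p p0 Hp] := inactive_slack.
have ue0 : 0 < `|u| + e by rewrite ltr_wpDl.
exists (Num.min tau (p / (`|u| + e))) => [|t].
  by rewrite lt_min tau0 divr_gt0.
rewrite lt_min => /and3P[t0 ttau tp].
have [|z hz zu] := Htau t; first by rewrite t0.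
exists z; split=> //; last exact: lagrangian_active.
move/active_map0P : hz => hz.
have zp : `|z - z0| < p.
  rewrite -[z - z0](subrK (t *: u)) (le_lt_trans (ler_normD _ _))//.
  rewrite normrZ gtr0_norm//; move: tp; rewrite ltr_pdivlMr//.
  by apply: le_lt_trans; rewrite mulrDr addrC (mulrC t e) lerD2l.
split=> k sk; first by rewrite hz// !inE sk.
have [kS|kS] := boolP (k \in S); first by rewrite hz.
exact: Hp.
Qed.

End Sensitivity.

(** * The expansions *)

Lemma near_right (R : realType) (tau : R) :
  0 < tau -> \forall t \near 0^'+, 0 < t < tau.
Proof.
move=> tau0; near=> t; apply/andP; split; near: t.
  exact: nbhs_right_gt.
exact: nbhs_right_lt.
Unshelve. all: by end_near. Qed.

(** The conditional expectations enter only as two smooth objectives. *)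
Theorem sensitivity_expansion (R : realType) (d m s : nat)
    (h : 'I_m -> 'cV[R]_d -> R) (f0 fj : 'cV[R]_d -> R)
    (z0 : 'cV[R]_d) (nu0 : 'cV[R]_m) (v : R -> R) (zj : R -> 'cV[R]_d) :
  let F := fun (t : R) (z : 'cV[R]_d) => f0 z + t * (fj z - f0 z) in
  let Z := feasible s h in
  (forall t, 0 <= t <= 1 -> argmin (F t) Z !=set0 ->
     is_min (F t @` Z) (v t)) ->
  (forall t, 0 <= t <= 1 -> argmin (F t) Z !=set0 ->
     argmin (F t) Z (zj t)) ->
  (forall k, twice_continuously_differentiable (h k)) ->
  twice_continuously_differentiable f0 ->
  twice_continuously_differentiable fj ->
  argmin f0 Z = [set z0] ->
  (exists alpha t0 : R, [/\ 0 < t0, t0 <= 1,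
     forall t, 0 <= t < t0 -> [set z | Z z /\ F t z <= alpha] !=set0 &
     exists M : R, forall t, 0 <= t < t0 ->
       forall z, Z z -> F t z <= alpha -> `|z| <= M]) ->
  unique (lagrange_multiplier s h f0 z0) nu0 ->
  (forall k, k \in active_ineq s h z0 -> 0 < nu0 k 0) ->
  (forall u, critical_cone s h z0 u -> u != 0 ->
     0 < dot u (hess_lagrangian h f0 z0 nu0 *m u)) ->
  let H := hess_lagrangian h f0 z0 nu0 in
  let g := grad fj z0 - grad f0 z0 in
  let solution := fun w => kkt_matrix s h f0 z0 nu0 *m w = col_mx (- g) 0 in
  (exists! w, solution w) /\
  forall w, solution w ->
    let dz := usubmx w in
    v = (fun t => (1 - t) * f0 z0 + t * fj z0
                  + 2^-1 * t ^+ 2 * (dot dz (H *m dz) + 2 * dot dz g))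
        +o_ (0^'+) (fun t => t ^+ 2) /\
    zj = (fun t => z0 + t *: dz) +o_ (0^'+) (fun t => t).
Proof.
move=> F Z vmin zjmin h_C2 f0_C2 fj_C2 z0min [alpha [t0 [t00 t01 ne [M bd]]]].
move=> nu_uniq nu_pos sosc H g solution.
have [Zz0 _] : argmin f0 Z z0 by rewrite z0min.
have nu_mult := nu_uniq.1.
have Jfree := active_jacobian_row_free nu_uniq nu_pos.
have Hpos u : active_jacobian s h z0 *m u = 0 -> u != 0 -> 0 < dot u (H *m u).
  by move=> /kernel_critical; exact: sosc.
have kkt_inv := kkt_unit Hpos Jfree.
split.
  exists (invmx (kkt_matrix s h f0 z0 nu0) *m col_mx (- g) 0).
  split=> [|w sw]; first by rewrite /solution mulKVmx.
  by rewrite -sw mulKmx.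
move=> w sw dz; have := sw; rewrite /solution kkt_mul -/dz -/H.
move=> /eq_col_mx[stationary tangent].
pose G z := fj z - f0 z.
have Hsym := hess_lagrangian_sym z0 nu0 h_C2 f0_C2.
have Lexp := lagrangian_expansion h_C2 f0_C2 nu_mult.
have Gexp : first_order1 G z0 g.
  have [df0 _ _] := f0_C2; have [dfj _ _] := fj_C2.
  by apply: first_order1B; exact: first_order1_diff.
have L0 : lagrangian h f0 nu0 z0 = f0 z0.
  by rewrite (lagrangian_active nu_mult)//; exact: active_map_z0.
have [c c0 pen] := lagrangian_penalty nu_mult nu_pos.
have [rho [kappa [rho0 kappa0 coer]]] := finsler Hpos.
have hS_exp : first_order (active_map s h z0) z0 (active_jacobian s h z0).
  move=> e e0; have [p p0 Hp] := active_map_strict s z0 h_C2 e0.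
  by exists p => // z zp; apply: Hp; rewrite ?subrr ?normr0.
have low := lower_growth Hsym stationary tangent Lexp Gexp L0 hS_exp
  (active_map_z0 Zz0) c0 pen rho0 kappa0 coer.
have up := upper_growth Hsym stationary Lexp Gexp L0
  (feasible_curve h_C2 Zz0 nu_mult Jfree tangent).
have cf0 : continuous f0.
  by apply: differentiable_map_continuous; have [] := f0_C2.
have cfj : continuous fj.
  by apply: differentiable_map_continuous; have [] := fj_C2.
have cG : continuous G by move=> z; exact: (cvgB (cfj z) (cf0 z)).
have clZ : closed Z.
  apply: feasible_closed => k.
  by apply: differentiable_map_continuous; have [] := h_C2 k.
have stab := argmin_stability clZ cf0 cG z0min t00 ne bd.
pose base t := f0 z0 + t * G z0 + t ^+ 2 * quad_model H g dz.
(* Both bounds at the minimizer: the lower one at zj t, whose value is v t, and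
   the upper one at a feasible competitor. *)
have est e : 0 < e -> exists2 tau, 0 < tau & forall t, 0 < t < tau ->
    `|v t - base t| <= e * t ^+ 2 /\
    kappa / 4 * `|zj t - z0 - t *: dz| ^+ 2 <= 2 * (e * t ^+ 2).
  move=> e0.
  have [p p0 Hlow] := low _ e0.
  have [tau1 tau10 Hup] := up _ e0.
  have [tau2 tau20 Hst] := stab _ p0.
  exists (Num.min (Num.min p tau1) (Num.min tau2 1)).
    by rewrite !lt_min p0 tau10 tau20 ltr01.
  move=> t; rewrite !lt_min.
  move=> /andP[tp /andP[/andP[tpp ttau1] /andP[ttau2 t1]]].
  have t01' : 0 <= t <= 1 by rewrite !ltW.
  have [|ex near] := Hst t; first by rewrite tp.
  have zm := zjmin t t01' ex.
  have [Zzj zjle] := zm.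
  have [[y Zy vy] vle] := vmin t t01' ex.
  have vE : v t = f0 (zj t) + t * G (zj t).
    apply/eqP; rewrite eq_le; apply/andP; split.
      by apply: vle; exists (zj t).
    by rewrite -vy; exact: zjle.
  have [|x Zx xle] := Hup t; first by rewrite tp.
  have vx : v t <= f0 x + t * G x by apply: vle; exists x.
  have := Hlow t (zj t); rewrite tp tpp => /(_ isT Zzj (near _ zm)).
  rewrite -vE => low_t.
  have k0 : 0 <= kappa / 4 * `|zj t - z0 - t *: dz| ^+ 2.
    by rewrite mulr_ge0 ?sqr_ge0// divr_ge0// ltW.
  rewrite /base; split; last by lra.
  by rewrite ler_norml; apply/andP; split; lra.
split; apply/eqaddoP => e e0 /=.
  have [tau tau0 Ht] := est e e0.
  have := near_right tau0; apply: filterS => t tt.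
  have [ht _] := Ht t tt; move: ht.
  have : e * t ^+ 2 <= e * `|t ^+ 2| by rewrite ler_pM2l// ler_norm.
  move=> h1 h2; apply: le_trans h1; apply: le_trans h2.
  rewrite le_eqVlt; apply/orP; left; apply/eqP; congr (`|_|).
  by rewrite /base /quad_model /G !fctE; field.
(* Chosen so that the bound 2 e' t^2 on kappa / 4 |.|^2 becomes
   |.|^2 <= (e t)^2. *)
pose e' := e ^+ 2 * (kappa / 8).
have e'0 : 0 < e' by rewrite mulr_gt0 ?exprn_gt0// divr_gt0.
have [tau tau0 Ht] := est e' e'0.
have := near_right tau0; apply: filterS => t tt.
have [_ ht] := Ht t tt.
have t0' : 0 < t by case/andP: tt.
have : e * t <= e * `|t| by rewrite ler_pM2l// ler_norm.
apply: le_trans; rewrite !fctE opprD addrA.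
rewrite -ler_sqr ?nnegrE ?mulr_ge0 ?(ltW t0') ?(ltW e0)//.
have k4 : 0 < kappa / 4 by rewrite divr_gt0.
rewrite -(ler_pM2l k4) (le_trans ht)// /e' exprMn.
by rewrite le_eqVlt; apply/orP; left; apply/eqP; field.
Qed.

Theorem theorem4 (R : realType)
  (dO dY : measure_display) (Omega : measurableType dO)
  (TY : measurableType dY) (P : probability Omega R) (p d : nat)
  (X : {RV P >-> borelRn R p}) (Y : {RV P >-> TY})
  (c : 'cV[R]_d -> TY -> R)
  (region : 'I_3 -> set (borelRn R p))
  (region_meas : forall k, measurable (region k))
  (region_cover : region 0 = region 1 `|` region 2)
  (region_disj : region 1 `&` region 2 = set0)
  (j : 'I_3) (hj : j = 1 \/ j = 2)
  (region_pos : (0 < P (X @^-1` region j))%E)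
  (cost_int : forall z,
     P.-integrable (X @^-1` region 0) (fun w => (c z (Y w))%:E))
  (m s : nat) (hsm : (s <= m)%N) (h : 'I_m -> 'cV[R]_d -> R)
  (z0 : 'cV[R]_d) (nu0 : 'cV[R]_m) (v : R -> R) (zj : R -> 'cV[R]_d) :
  let f := regional_cost P X Y c region in
  let F := fun (t : R) (z : 'cV[R]_d) => f 0 z + t * (f j z - f 0 z) in
  let Z := feasible s h in
  (forall t, 0 <= t <= 1 -> argmin (F t) Z !=set0 ->
     is_min (F t @` Z) (v t)) ->
  (forall t, 0 <= t <= 1 -> argmin (F t) Z !=set0 ->
     argmin (F t) Z (zj t)) ->
  (forall k, twice_continuously_differentiable (h k)) ->
  twice_continuously_differentiable (f 0) ->
  twice_continuously_differentiable (f j) ->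
  argmin (f 0) Z = [set z0] ->
  (exists alpha t0 : R, [/\ 0 < t0, t0 <= 1,
     forall t, 0 <= t < t0 -> [set z | Z z /\ F t z <= alpha] !=set0 &
     exists M : R, forall t, 0 <= t < t0 ->
       forall z, Z z -> F t z <= alpha -> `|z| <= M]) ->
  unique (lagrange_multiplier s h (f 0) z0) nu0 ->
  (forall k, k \in active_ineq s h z0 -> 0 < nu0 k 0) ->
  mangasarian_fromovitz s h z0 ->
  (forall u, critical_cone s h z0 u -> u != 0 ->
     0 < dot u (hess_lagrangian h (f 0) z0 nu0 *m u)) ->
  let H := hess_lagrangian h (f 0) z0 nu0 in
  let g := grad (f j) z0 - grad (f 0) z0 in
  let solution := fun w => kkt_matrix s h (f 0) z0 nu0 *m w = col_mx (- g) 0 in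
  (exists! w, solution w) /\
  forall w, solution w ->
    let dz := usubmx w in
    v = (fun t => (1 - t) * f 0 z0 + t * f j z0
                  + 2^-1 * t ^+ 2 * (dot dz (H *m dz) + 2 * dot dz g))
        +o_ (0^'+) (fun t => t ^+ 2) /\
    zj = (fun t => z0 + t *: dz) +o_ (0^'+) (fun t => t).
Proof.
move=> f F Z vmin zjmin h_C2 f0_C2 fj_C2 z0min infc nu_uniq nu_pos _ sosc.
exact: (sensitivity_expansion vmin zjmin h_C2 f0_C2 fj_C2 z0min infc nu_uniq
  nu_pos sosc).
Qed.
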